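(* Let $(X,d,m)$ be a compact Ahlfors $Q$-regular space, $Q>0$, let $1<p<+\infty$, $\frac1p+\frac1{p'}=1$, $\frac1{p'}\le s<1$, and let $\Psi\ge1$ be the quasi-additivity constant described in the context. For $x_0\in X$ consider the region $$\Omega_{x_0}:=\big\{(x,y)\in X\times(0,+\infty) : x\in B_d\big(x_0,\Psi\cdot\eta^*_{X,p}(x_0,y)\big)\big\}.$$ Let $f\in L^p(X)$. Then $$\lim_{\substack{P=(x,y)\to(x_0,0)\\ P\in\Omega_{x_0}}}PI(K_{X,s}*f)(P)=K_{X,s}*f(x_0)$$ for $m$-almost all $x_0\in X$.
   Context: $(X,d,m)$ is a compact metric measure space, $B_d(x,r)=\{y\in X: d(x,y)<r\}$. It is Ahlfors $Q$-regular: there are constants $0<C_1\le C_2<+\infty$ with $C_1r^Q\le m(B_d(x,r))\le C_2r^Q$ for all $x\in X$ and $0<r<\mathrm{diam}(X)$. Throughout, $m$ is taken to be the $Q$-dimensional Hausdorff measure (in particular it is a regular Borel measure). Riesz kernel: $K_{X,s}(x,y)=d(x,y)^{-Qs}$ (equal to $+\infty$ on the diagonal), and $K_{X,s}*f(x)=\int_X K_{X,s}(x,y)f(y)\,dm(y)$. Capacity: for $E\subseteq X$, $C_{K_{X,s},p}(E):=\inf\{\|f\|^p_{L^p(X,m)}: f\in L^p(X,m),\ K_{X,s}*f(x)\ge1\ \forall x\in E\}$. Radii: for $x\in X$, $r>0$, $\eta_{X,p}(x,r):=\inf\{R>0: m(B_d(x,R))\ge C_{K_{X,s},p}(B_d(x,r))\}$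 (when it exists, i.e. when this set is non-empty, which is assumed; it holds for all sufficiently small $r$), and $\eta^*_{X,p}(x,r):=\max\{r,\eta_{X,p}(x,r)\}$. The constant $\Psi=\Psi(X,p,s)\ge1$ is a constant with the following quasi-additivity property: for all $M\ge1$ there is $1<\tilde A<+\infty$ depending only on $X,p,s,M$ such that for any countable family of balls $\{B_d(x_k,r_k)\}_k$ in $X$ with $\{B_d(x_k,\Psi\,\eta^*_{X,p}(x_k,M r_k))\}_k$ disjoint, and any compact $E=\bigcup_kE_k$ with $E_k\subseteq B_d(x_k,r_k)$, one has $\sum_kC_{K_{X,s},p}(E_k)\le\tilde A\,C_{K_{X,s},p}(E)$. Poisson integral: for $g\in L^p(X)$ and $(x,y)\in X\times(0,+\infty)$, $$PI(g)(x,y):=\int_X C(x,y)\,\frac1{y^Q}\sum_{k=0}^{+\infty}\frac{\chi_{B_d(x,2^ky)}(z)}{2^{(Q+1)k}}\,g(z)\,dm(z),\qquad C(x,y):=\Big[\int_X\frac1{y^Q}\sum_{k=0}^{+\infty}\frac{\chi_{B_d(x,2^ky)}(z)}{2^{(Q+1)k}}\,dm(z)\Big]^{-1}.$$ The space $X\times[0,+\infty)$ carries the metric $\max\{d(x_1,x_2),|y_1-y_2|\}$. *)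

(* Defs.v *)
From HB Require Import structures.
From mathcomp Require Import all_boot all_order all_algebra.
From mathcomp Require Import all_classical all_reals all_analysis.

Set Implicit Arguments.
Unset Strict Implicit.
Unset Printing Implicit Defensive.

Import Order.TTheory GRing.Theory Num.Theory.
Import numFieldNormedType.Exports.

Local Open Scope classical_set_scope.
Local Open Scope ring_scope.
Local Open Scope ereal_scope.

(* [g_sigma_algebraType] needs a pointed carrier, hence nonempty spaces; on an
   empty space every statement about almost all points is vacuous. *)
#[short(type="pmetricType")]
HB.structure Definition PointedMetric (K : numDomainType) :=
  { X of Metric K X & Pointed X }.

Notation borel X := (g_sigma_algebraType (@open X)).

Section metric_notions.
Context {R : realType} (X : pmetricType R).
Implicit Types (A : set X) (Q : R).

(* The supremum over the empty set is -oo, so the maximum gives the empty set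
   diameter 0. *)
Definition diam A : \bar R :=
  maxe 0 (ereal_sup [set (mdist x y)%:E | x in A & y in A]).

(* Ball whose radius may be +oo, in which case it is the whole space. *)
Definition eball (x : X) (r : \bar R) : set X :=
  [set z | (mdist x z)%:E < r].

Definition hausdorff_pre Q (delta : R) A : \bar R :=
  ereal_inf [set \sum_(0 <= k <oo) (diam (U k) `^ Q) |
    U in [set U : nat -> set X |
      A `<=` \bigcup_k U k /\ forall k, diam (U k) <= delta%:E]].

(* Unnormalized: no multiplicative constant in front of the sum of diam^Q. *)
Definition hausdorff_measure Q A : \bar R :=
  ereal_sup [set hausdorff_pre Q delta A | delta in [set delta : R | (0 < delta)%R]].

End metric_notions.

Section potentials.
Context {R : realType} (X : pmetricType R).
Variable m : {measure set (borel X) -> \bar R}.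
Variables Q s p : R.

Definition is_hausdorff_measure : Prop :=
  forall A : set (borel X), measurable A -> m A = hausdorff_measure Q (A : set X).

Definition ahlfors_regular : Prop :=
  exists C1 C2 : R, [/\ (0 < C1)%R, (C1 <= C2)%R &
    forall (x : X) (r : R), (0 < r)%R -> r%:E < diam [set: X] ->
      (C1 * r `^ Q)%:E <= m (ball x r) /\ m (ball x r) <= (C2 * r `^ Q)%:E].

Definition riesz_kernel (x y : X) : \bar R :=
  if x == y then +oo else (mdist x y `^ (- (Q * s)))%:E.

(* Where the positive and negative parts both have infinite integral, the
   library's integral is -oo; so [1 <= riesz_potential f x] entails that the
   integral is well defined. *)
Definition riesz_potential (f : X -> R) (x : X) : \bar R :=
  \int[m]_y (riesz_kernel x y * (f y)%:E).

Definition capacity (E : set X) : \bar R :=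
  ereal_inf [set 'N[m]_(p%:E)[EFin \o f] `^ p |
    f in [set f : borel X -> R | f \in Lfun m p%:E /\
      forall x, E x -> 1 <= riesz_potential f x]].

(* The infimum is +oo when no such radius exists, and [eball] is then the whole
   space. This affects neither definition below: in [quasi_additive] it can only
   occur for a family consisting of one ball, where the conclusion is trivial,
   and in [approach_region] only for y away from 0. *)
Definition eta (x : X) (r : R) : \bar R :=
  ereal_inf [set rho%:E | rho in [set rho : R |
    (0 < rho)%R /\ capacity (ball x r) <= m (ball x rho)]].

Definition eta_star (x : X) (r : R) : \bar R := maxe r%:E (eta x r).

(* Countable families are indexed by arbitrary subsets [D] of [nat]. *)
Definition quasi_additive (Psi : R) : Prop :=
  forall M : R, (1 <= M)%R -> exists A : R, (1 < A)%R /\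
    forall (D : set nat) (x : nat -> X) (r : nat -> R) (E : nat -> set X),
      (forall k, D k -> (0 < r k)%R) ->
      trivIset D (fun k => eball (x k) (Psi%:E * eta_star (x k) (M * r k))) ->
      (forall k, D k -> E k `<=` ball (x k) (r k)) ->
      compact (\bigcup_(k in D) E k) ->
      \esum_(k in D) capacity (E k) <= A%:E * capacity (\bigcup_(k in D) E k).

Definition approach_region (Psi : R) (x0 : X) : set (X * R) :=
  [set P | (0 < P.2)%R /\ eball x0 (Psi%:E * eta_star x0 P.2) P.1].

Definition poisson_weight (x : X) (y : R) (z : X) : \bar R :=
  ((y `^ Q)^-1)%:E *
  \sum_(0 <= k <oo)
    (\1_(ball x (2 ^+ k * y)%R) z / 2 `^ ((Q + 1) * k%:R))%:E.

Definition poisson_normalization (x : X) (y : R) : \bar R :=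
  (\int[m]_z poisson_weight x y z)^-1.

(* [g] is extended-valued so that it may be a Riesz potential. *)
Definition poisson_integral (g : X -> \bar R) (P : X * R) : \bar R :=
  \int[m]_z (poisson_normalization P.1 P.2 * poisson_weight P.1 P.2 z * g z).

End potentials.

(* Main.v *)
(** Tonelli gives |PI(K * f)(x, y)| <= C int max(y, d(x, u))^(-Qs) |f(u)| dm(u).
    Write f as a bounded function plus a remainder small in L^p. The potential of
    the bounded part is continuous and PI is an approximate identity, so it remains
    to prove a weak type (p, p) bound for the supremum over the approach region of
    the right-hand side, the potential of |f| truncated at scale y.

    A point x0 where this supremum exceeds lambda comes with a point (x, y) of its
    region and a radius rho >= y such that d(x0, x) <= Psi rho and either rho = y
    or m(B(x0, rho)) < Cap(B(x0, y)). By Vitali's lemma it suffices to bound the sum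
    of the m(B(x0, rho)) over such points for which the balls B(x0, (Psi + 1) rho)
    are disjoint. Split the potential at the latter ball. Outside of it the kernel
    at x is dominated by the kernel at every point of B(x0, rho); after Jensen's
    inequality these parts sum up to C ||f||_p^p, since K is integrable uniformly.
    Inside, Hoelder's inequality brings in the energy
    G(x, y) = int max(y, d(x, u))^(-Qsp') dm(u), which by Ahlfors regularity does
    not depend on x up to constants, while testing the capacity on a multiple of
    max(y, d(x0, .))^(-Qs(p'-1)) gives Cap(B(x0, y)) <= C G(x0, y)^(1-p). Hence
    m(B(x0, rho)) G(x, y)^(p-1) is bounded, and these parts sum up to C ||f||_p^p
    by disjointness. *)

Require Import Defs.
From HB Require Import structures.
From mathcomp Require Import all_boot all_order all_algebra.
From mathcomp Require Import all_classical all_reals all_analysis.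
From mathcomp Require Import measurable_realfun lra ring.
Import Order.TTheory GRing.Theory Num.Theory.
Import numFieldNormedType.Exports.
Set Implicit Arguments.
Unset Strict Implicit.
Unset Printing Implicit Defensive.

Local Open Scope classical_set_scope.
Local Open Scope ring_scope.

(** * Topology, coverings and integrals *)

(** The supremum that is estimated also controls the value at x0: the point (x0, y) lies in the
    region of x0 for every height y, and the truncated potentials at (x0, y) increase to the
    potential as y tends to 0. One maximal estimate therefore yields the finiteness of K * f(x0),
    the smallness of the remainder in it, and the smallness of the remainder in PI near x0.

    Truncation is natural because averages over balls of radius at least y do not see the
    singularity of K at a finer scale. It is also necessary: K itself may fail to lie in L^p', so
    Hoelder's inequality has a finite constant only at a fixed scale, and this constant may blow up
    as y tends to 0. The width of the region is what compensates the blow-up.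

    Two further facts shape the statements. Superlevel sets of the maximal function are not known to
    be measurable, so their size is always expressed by a measurable superset. Regularity says
    nothing on radii beyond the diameter; on a space of diameter 0 it is void, and the conclusion
    then comes from the vanishing of the Hausdorff measure. *)

Lemma countable_enum (T : Type) (A : set T) :
  countable A -> A !=set0 -> exists e : nat -> T, range e = A.
Proof.
move=> /countable_injP[f finj] [a0 Aa0].
have sel (n : nat) : exists a, A a /\ forall b, A b -> f b = n -> a = b.
  case: (pselect (exists2 b, A b & f b = n)) => [[b Ab fb]|nb].
    by exists b; split=> // c Ac fc; apply: finj; rewrite ?inE// fb fc.
  by exists a0; split=> // b Ab fb; case: nb; exists b.
have [e he] := choice sel; exists e; apply/seteqP; split=> [_ [n _ <-]|a Aa].
  exact: (he n).1.
by exists (f a) => //; exact: (he (f a)).2.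
Qed.

(** Each basic open set contained in some member is assigned one such index. These countably many
    indices suffice, since every point of the union lies in a basic set of this kind. *)
Lemma lindelof (T : ptopologicalType) (I : Type) (D : set I) (F : I -> set T) :
  @second_countable T -> D !=set0 -> (forall i, D i -> open (F i)) ->
  exists e : nat -> I, (forall n, D (e n)) /\
    \bigcup_(i in D) F i = \bigcup_n F (e n).
Proof.
move=> [B cB [oB bB]] [i0 Di0] oF.
have sel (b : set T) : exists i, D i /\
    ((exists2 j, D j & b `<=` F j) -> b `<=` F i).
  case: (pselect (exists2 j, D j & b `<=` F j)) => [[j Dj bj]|nj].
    by exists j.
  by exists i0; split.
have [c hc] := choice sel.
have cBn0 : c @` B !=set0.
  have [b [Bb _] _] := bB (point : T) setT filterT.
  by exists (c b), b.
have cBc : countable (c @` B) by exact: sub_countable (card_image_le _ _) cB.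
have [e eE] := countable_enum cBc cBn0.
exists e; split=> [n|].
  have : (c @` B) (e n) by rewrite -eE; exists n.
  by move=> [b _ <-]; exact: (hc b).1.
apply/seteqP; split=> x [i Di Fix].
- have [b [Bb bx] bF] := bB x (F i) (open_nbhs_nbhs (conj (oF _ Di) Fix)).
  have : (c @` B) (c b) by exists b.
  rewrite -eE => -[n _ enE]; exists n => //; rewrite enE.
  by apply: (hc b).2 => //; exists i.
- have : (c @` B) (e i) by rewrite -eE; exists i.
  by move=> [b _ cbE]; exists (c b); [exact: (hc b).1|rewrite cbE].
Qed.

(** Second countability makes an open set a countable union of open boxes. This gives the joint
    measurability of the distance, on which the use of Fubini's theorem rests. *)
Lemma open_prod_measurable (T1 T2 : ptopologicalType) (S : set (T1 * T2)) :
  @second_countable T1 -> @second_countable T2 -> open S ->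
  measurable (S : set (borel T1 * borel T2)).
Proof.
move=> [B cB [oB bB]] [C cC [oC bC]] oS.
pose I := [set bc : set T1 * set T2 | [/\ B bc.1, C bc.2 & bc.1 `*` bc.2 `<=` S]].
have SE : S = \bigcup_(bc in I) (bc.1 `*` bc.2).
  apply/seteqP; split=> [[x y] Sxy|z [bc [_ _ +]]]; last exact.
  have [[U V] /= [Ux Vy] UVS] := open_nbhs_nbhs (conj oS Sxy).
  have [b [Bb bx] bU] := bB x U Ux.
  have [c [Cc cy] cV] := bC y V Vy.
  exists (b, c) => //; split => // -[x' y'] /= [bx' cy'].
  by apply: UVS; split; [exact: bU|exact: cV].
have [I0|IN0] := pselect (I !=set0); last first.
  rewrite SE; have -> : I = set0.
    by apply/seteqP; split=> // i Ii; case: IN0; exists i.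
  by rewrite bigcup_set0; exact: measurable0.
have cI : countable I.
  apply: sub_countable (countableX cB cC).
  by apply: subset_card_le => -[b c] [] /= Bb Cc _; split.
have [e eE] := countable_enum cI I0.
have -> : S = \bigcup_n ((e n).1 `*` (e n).2).
  rewrite SE; apply/seteqP; split=> z.
    move=> [bc]; rewrite -eE => -[n _ <-] ez; by exists n.
  by move=> [n _ ez]; exists (e n) => //; rewrite -eE; exists n.
apply: bigcupT_measurable => n.
have : I (e n) by rewrite -eE; exists n.
move=> [Bn Cn _]; apply: measurableX.
  by apply: sub_sigma_algebra; exact: oB.
by apply: sub_sigma_algebra; exact: oC.
Qed.

(** Hoelder's inequality raised to the power p, with p / q rewritten as p - 1. No roots remain, and
    the integrals may be infinite. *)
Lemma hoelder_pow d (T : measurableType d) (R : realType)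
  (mu : {measure set T -> \bar R}) (f g : T -> R) (p q : R) :
  measurable_fun setT f -> measurable_fun setT g ->
  1 < p -> p^-1 + q^-1 = 1 ->
  (((\int[mu]_x (`|f x * g x|)%:E) `^ p) <=
  (\int[mu]_x (`|f x| `^ p)%:E) * (\int[mu]_x (`|g x| `^ q)%:E) `^ (p - 1))%E.
Proof.
move=> mf mg p1 pq.
have p0 : 0 < p by apply: lt_trans p1.
have q0 : 0 < q.
  by rewrite -invr_gt0 -[q^-1](addKr p^-1) pq addrC subr_gt0 invf_lt1.
have N0 : (0 <= \int[mu]_x `|(EFin \o (f \* g)%R) x|)%E by exact: integral_ge0.
have := hoelder mu mf mg p0 q0 pq.
rewrite Lnorm1 => h.
have {h} := gt0_ler_poweR (ltW p0) _ _ h.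
rewrite !in_itv/= !leey N0 mule_ge0 ?Lnorm_ge0// => /(_ isT isT).
rewrite poweRM ?Lnorm_ge0// poweR_Lnorm ?gt_eqF//.
have -> : ('N[mu]_q%:E[EFin \o g] `^ p =
    (\int[mu]_x (`|g x| `^ q)%:E) `^ (p - 1))%E.
  rewrite unlock -poweRrM; congr (_ `^ _)%E.
  by rewrite -[q^-1](addKr p^-1) pq mulrDl mul1r addrC mulNr mulVf// gt_eqF.
by [].
Qed.

Lemma measure_bigsetU_le d (T : measurableType d) (R : realType)
  (mu : {measure set T -> \bar R}) (I : Type) (s : seq I) (F : I -> set T) :
  (forall i, measurable (F i)) ->
  (mu (\big[setU/set0]_(i <- s) F i) <= \sum_(i <- s) mu (F i))%E.
Proof.
move=> mF; elim: s => [|i s IH]; first by rewrite !big_nil measure0.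
rewrite !big_cons; apply: le_trans (measureU2 _ _ _) _ => //.
  exact: bigsetU_measurable.
exact: leeD2l.
Qed.

Section metric_balls.
Context {R : realType} (X : metricType R).

Lemma mem_ballE (x z : X) (r : R) : ball x r z = (mdist x z < r).
Proof. by rewrite ballEmdist. Qed.

Lemma metric_ball_open (x : X) (r : R) : open (ball x r).
Proof.
rewrite openE => z; rewrite mem_ballE => xz; apply/nbhs_ballP.
exists (r - mdist x z); first by rewrite /= subr_gt0.
move=> w; rewrite !mem_ballE ltrBrDl => zw.
exact: le_lt_trans (metric_triangle _ _ _) zw.
Qed.

(** The list is sorted by increasing radius, so the balls selected from the tail are at least as
    large as the head. If one of them meets the head, its triple swallows the head; otherwise the
    head is added. *)
Lemma finite_vitali (r : X -> R) (s : seq X) :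
  (forall e, e \in s -> 0 < r e) ->
  exists D : seq X, [/\ uniq D, {subset D <= s},
    trivIset [set` D] (fun e => ball e (r e)) &
    forall e, e \in s -> exists2 e', e' \in D & ball e (r e) `<=` ball e' (3 * r e')].
Proof.
pose LE x y := r x <= r y.
have LE_trans : transitive LE by move=> x y z; exact: le_trans.
wlog : s / sorted LE s.
  have : sorted LE (sort LE s) by apply: sort_sorted => x y; exact: le_total.
  move=> /[swap] /[apply] + s0 => -[e|D [uD Ds tD H]].
    by rewrite mem_sort; exact: s0.
  exists D; split => //.
  - by move=> x /Ds; rewrite mem_sort.
  - by move=> i; rewrite -(mem_sort LE) => /H.
elim: s => [_ _|i s IH]; first by exists [::]; split.
move=> /= is_s s0.
have ss : sorted LE s by exact: path_sorted is_s.
have [|D [uD Ds tD H]] := IH ss.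
  by move=> e es; apply: s0; rewrite inE es orbT.
have Dis e : e \in D -> e \in i :: s by move=> /Ds es; rewrite inE es orbT.
have ri : 0 < r i by apply: s0; rewrite mem_head.
have H' e : e \in s -> exists2 e', e' \in D & ball e (r e) `<=` ball e' (3 * r e').
  exact: H.
have [K|] := pselect (forall j, j \in D -> ball j (r j) `&` ball i (r i) = set0).
  have iD : i \notin D.
    apply/negP => /K; rewrite setIid => /seteqP[] /(_ i) + _; apply.
    by rewrite mem_ballE mdistxx.
  exists (i :: D); split => //.
  - by rewrite /= iD.
  - by move=> x; rewrite !inE => /predU1P[->|/Ds ->]; rewrite ?eqxx ?orbT.
  - move=> k l /= /[1!inE] /predU1P[->|kD] /[1!inE] /predU1P[->|lD] //.
    + by rewrite setIC K// => /set0P; rewrite eqxx.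
    + by rewrite K// => /set0P; rewrite eqxx.
    + exact: tD.
  - move=> e /[1!inE] /predU1P[->|/H' [e' e'D ee']].
      exists i; first by rewrite mem_head.
      by apply: le_ball; rewrite ler_peMl ?ler1n// ltW.
    by exists e' => //; rewrite inE e'D orbT.
move=> /existsNP/cid[k] /not_implyP[kD /eqP/set0P[z [kz iz]]].
exists D; split => // e /[1!inE] /predU1P[->|/H'//].
exists k => // w.
have rik : r i <= r k.
  by have /allP := order_path_min LE_trans is_s; apply; exact: Ds.
move: kz iz; rewrite !mem_ballE => kz iz iw.
have zw : mdist z w < r i + r i.
  by apply: le_lt_trans (metric_triangle z i w) _; rewrite (metric_sym z) ltrD.
apply: le_lt_trans (metric_triangle k z w) _; lra.
Qed.

End metric_balls.

(** Lindelof's property replaces the balls by countably many, whose union is the superset sought.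
    Every finite stage is bounded by its own Vitali selection, and continuity from below passes to
    the union, so neither [E] has to be measurable nor the radii bounded. *)
Lemma vitali_cover (R : realType) (X : pmetricType R)
    (m : {measure set (borel X) -> \bar R}) (E : set X) (r : X -> R) (B : \bar R) :
  @second_countable X -> (0 <= B)%E -> (forall e, E e -> 0 < r e) ->
  (forall D : seq X, uniq D -> (forall e, e \in D -> E e) ->
    trivIset [set` D] (fun e => ball e (r e)) ->
    (\sum_(e <- D) m (ball e (3 * r e)) <= B)%E) ->
  exists U : set (borel X), [/\ measurable U, E `<=` U & (m U <= B)%E].
Proof.
move=> sc B0 r0 hB; have [En0|E0] := pselect (E !=set0); last first.
  exists set0; split; rewrite ?measure0//.
  by move=> e Ee; case: E0; exists e.
have mball (e : X) (q : R) : measurable (ball e q : set (borel X)).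
  by apply: sub_sigma_algebra; exact: metric_ball_open.
have [e [eE eU]] := lindelof (F := fun e => ball e (r e)) sc En0
  (fun e _ => @metric_ball_open _ _ e (r e)).
pose F n : set (borel X) := ball (e n) (r (e n)).
pose V n : set (borel X) := \big[setU/set0]_(i < n) F i.
have mV n : measurable (V n).
  by apply: bigsetU_measurable => i _; exact: mball.
exists (\bigcup_n V n); split.
- exact: bigcupT_measurable.
- move=> x Ex.
  have : (\bigcup_(i in E) ball i (r i)) x.
    by exists x => //; rewrite mem_ballE mdistxx r0.
  rewrite eU => -[n _ Fn]; exists n.+1 => //.
  by rewrite /V big_ord_recr/=; right.
- have cvgV : (m \o V) n @[n --> \oo] --> m (\bigcup_n V n).
    apply: nondecreasing_cvg_mu => //; first exact: bigcupT_measurable.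
    by move=> k l kl; apply/subsetPset; exact: subset_bigsetU.
  rewrite -(cvg_lim _ cvgV)//; apply: lime_le; first exact: (cvgP _ cvgV).
  apply: nearW => n /=.
  have [|D [uD Ds tD H]] := @finite_vitali _ _ r [seq e i | i <- iota 0 n].
    by move=> _ /mapP[i _ ->]; exact: r0.
  apply: le_trans (hB D uD _ tD); last first.
    by move=> _ /Ds/mapP[i _ ->].
  apply: le_trans (@measure_bigsetU_le _ _ _ m _ D (fun e => ball e (3 * r e)) _) => //.
  apply: le_measure; rewrite ?inE//.
    by apply: bigsetU_measurable => i _; exact: mball.
  move=> x; rewrite /V -bigcup_mkord => -[i /= ltin Fix].
  have [|e' e'D ee'] := H (e i).
    by apply/mapP; exists i; rewrite // mem_iota.
  by rewrite -bigcup_seq; exists e' => //; exact: ee'.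
Qed.

Lemma lee_EFinMl (R : realType) (k : R) (x y : \bar R) :
  0 <= k -> (x <= y)%E -> (k%:E * x <= k%:E * y)%E.
Proof. by move=> k0 xy; rewrite lee_wpmul2l// lee_fin. Qed.

Section nonnegative_integrals.
Local Open Scope ereal_scope.
Context d (T : measurableType d) (R : realType) (mu : {measure set T -> \bar R}).
Implicit Types (f : T -> \bar R) (A B C : set T).

Lemma ge0_integral_le_cst A f (c : R) : measurable A -> measurable_fun setT f ->
  (forall x, 0 <= f x) -> (forall x, A x -> f x <= c%:E) ->
  \int[mu]_(x in A) f x <= c%:E * mu A.
Proof.
move=> mA mf f0 fc; rewrite -integral_cst//; apply: ge0_le_integral => //.
by apply: measurable_funTS.
Qed.

Lemma ge0_cst_le_integral A f (c : R) : measurable A -> measurable_fun setT f ->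
  (0 <= c)%R -> (forall x, A x -> c%:E <= f x) ->
  c%:E * mu A <= \int[mu]_(x in A) f x.
Proof.
move=> mA mf c0 fc; rewrite -integral_cst//; apply: ge0_le_integral => //.
by apply: measurable_funTS.
Qed.

Lemma ge0_integral_setU_le A B C f : measurable A -> measurable B ->
  measurable C -> A `<=` B `|` C -> measurable_fun setT f ->
  (forall x, 0 <= f x) ->
  \int[mu]_(x in A) f x <= \int[mu]_(x in B) f x + \int[mu]_(x in C) f x.
Proof.
move=> mA mB mC ABC mf f0.
have mCB : measurable (C `\` B) by exact: measurableD.
apply: (@le_trans _ _ (\int[mu]_(x in B `|` (C `\` B)) f x)).
  apply: ge0_subset_integral => //; first exact: measurableU.
    by apply: measurable_funTS.
  by move=> x /ABC; rewrite setUDr setDv setD0.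
rewrite ge0_integral_setU//.
- apply: leeD2l; apply: ge0_subset_integral => //.
  by apply: measurable_funTS.
- by apply: measurable_funTS.
- by rewrite disj_set2E setDIK.
Qed.

End nonnegative_integrals.

(** * The truncated kernel *)

Section truncated_kernel.
Context {R : realType} {X : metricType R}.
Implicit Types (b c y : R) (x u : X).

(** The exponent is a parameter because three of them occur: [Q s] for the potential, [Q s p'] for
    the energy and [Q s (p' - 1)] for the test function of the capacity. *)
Definition trunc_kernel b y x u : R := Num.max y (mdist x u) `^ (- b).

Lemma trunc_kernel_gt0 b y x u : 0 < y -> 0 < trunc_kernel b y x u.
Proof. by move=> y0; rewrite powR_gt0// lt_max y0. Qed.

Lemma ler_powRN b (v w : R) : 0 <= b -> 0 < v -> v <= w -> w `^ (- b) <= v `^ (- b).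
Proof.
move=> b0 v0 vw; rewrite !powRN lef_pV2 ?posrE ?powR_gt0//.
  by rewrite ge0_ler_powR// nnegrE ltW// (lt_le_trans v0).
exact: lt_le_trans vw.
Qed.

Lemma trunc_kernel_le b y x u : 0 <= b -> 0 < y -> trunc_kernel b y x u <= y `^ (- b).
Proof. by move=> b0 y0; rewrite ler_powRN// le_max lexx. Qed.

Lemma ler_powRN_scale b c (v w : R) : 0 <= b -> 0 < c -> 0 < v -> v <= c * w ->
  w `^ (- b) <= c `^ b * v `^ (- b).
Proof.
move=> b0 c0 v0 vw.
have w0 : 0 < w by rewrite -(pmulr_rgt0 _ c0); exact: lt_le_trans vw.
have h : c `^ (- b) * w `^ (- b) <= v `^ (- b).
  by rewrite -powRM ?(ltW c0) ?(ltW w0)//; exact: ler_powRN.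
have -> : w `^ (- b) = c `^ b * (c `^ (- b) * w `^ (- b)).
  by rewrite mulrA -powRD ?subrr ?powRr0 ?mul1r// (gt_eqF c0) implybT.
by rewrite ler_wpM2l ?powR_ge0.
Qed.

Lemma trunc_kernel_exp b c y x u :
  trunc_kernel b y x u `^ c = trunc_kernel (b * c) y x u.
Proof. by rewrite /trunc_kernel -powRrM mulNr. Qed.

End truncated_kernel.

Section measurability.
Context {R : realType} {X : pmetricType R}.
Hypothesis sc : @second_countable X.

Lemma measurable_ball_borel (x : X) (r : R) : measurable (ball x r : set (borel X)).
Proof. by apply: sub_sigma_algebra; exact: metric_ball_open. Qed.

Lemma measurable_mdist2 :
  measurable_fun setT (fun z : borel X * borel X => mdist (z.1 : X) (z.2 : X)).
Proof.
apply: (measurability _ (RGenInftyO.measurableE R)) => // _ [_ [r ->] <-].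
rewrite setTI.
apply: (open_prod_measurable (S := [set z : X * X | mdist z.1 z.2 \in `]-oo, r[])) => //.
rewrite openE => -[x u] /=; rewrite in_itv/= => xur.
pose e := (r - mdist x u) / 2.
have e0 : 0 < e by rewrite divr_gt0// subr_gt0.
exists (ball x e, ball u e); first by split; exact: nbhsx_ballx.
move=> [x' u'] /= []; rewrite !mem_ballE in_itv/= => xx uu.
have := metric_triangle x' x u'; have := metric_triangle x u u'.
rewrite (metric_sym x' x) /e in xx uu *; lra.
Qed.

Lemma measurable_mdist (x : X) : measurable_fun setT (fun u : borel X => mdist x (u : X)).
Proof.
exact: (measurableT_comp measurable_mdist2 (measurable_pair1 (x : borel X))).
Qed.

Lemma measurable_trunc_kernel2 b y :
  measurable_fun setT (fun z : borel X * borel X => trunc_kernel b y (z.1 : X) (z.2 : X)).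
Proof.
apply: (measurableT_comp (measurable_powR (- b))).
by apply: measurable_maxr => //; exact: measurable_mdist2.
Qed.

Lemma measurable_trunc_kernel b y (x : X) :
  measurable_fun setT (fun u : borel X => trunc_kernel b y x (u : X)).
Proof.
exact: (measurableT_comp (measurable_trunc_kernel2 b y) (measurable_pair1 (x : borel X))).
Qed.

Lemma measurable_riesz_kernel2 Q s :
  measurable_fun setT (fun z : borel X * borel X => riesz_kernel Q s (z.1 : X) (z.2 : X)).
Proof.
rewrite /riesz_kernel.
have -> : (fun z : borel X * borel X => if (z.1 : X) == z.2 then +oo%E else
    ((mdist (z.1 : X) (z.2 : X) `^ (- (Q * s)))%:E)) =
  (fun z : borel X * borel X => if mdist (z.1 : X) (z.2 : X) <= 0 then +oo%E else
    ((mdist (z.1 : X) (z.2 : X) `^ (- (Q * s)))%:E)).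
  by apply/funext => z; rewrite leNgt mdist_gt0 negbK.
apply: measurable_fun_ifT => //.
  by apply: measurable_fun_ler => //; exact: measurable_mdist2.
apply/measurable_EFinP; apply: (measurableT_comp (measurable_powR _)).
exact: measurable_mdist2.
Qed.

Lemma measurable_riesz_kernel Q s (x : X) :
  measurable_fun setT (fun u : borel X => riesz_kernel Q s x (u : X)).
Proof.
exact: (measurableT_comp (measurable_riesz_kernel2 Q s) (measurable_pair1 (x : borel X))).
Qed.

End measurability.

(* Without integrability of [f]: when both parts of [f] have infinite integral and
   [0 < r], both sides are -oo. *)
Lemma ge0_integralZl_real d (T : measurableType d) (R : realType)
  (mu : {measure set T -> \bar R}) (f : T -> \bar R) (r : R) :
  measurable_fun setT f -> 0 <= r ->
  (\int[mu]_x (r%:E * f x) = r%:E * \int[mu]_x f x)%E.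
Proof.
move=> mf; rewrite le_eqVlt => /predU1P[<-|r0].
  by rewrite mul0e integral0_eq// => x _; rewrite mul0e.
rewrite [in LHS]integralE ge0_funeposM ?ge0_funenegM ?(ltW r0)// [in RHS]integralE.
rewrite !ge0_integralZl ?lee_fin ?(ltW r0)//; last 2 first.
  exact: measurable_funeneg.
  exact: measurable_funepos.
have : (0 <= \int[mu]_x f^\+ x)%E by exact: integral_ge0.
have : (0 <= \int[mu]_x f^\- x)%E by exact: integral_ge0.
case: (\int[mu]_x f^\- x)%E => [u _|_|//]; case: (\int[mu]_x f^\+ x)%E => [v _|_|//].
- by rewrite -[RHS]/((r * (v - u))%:E) mulrBr.
- by rewrite gt0_muley ?lte_fin.
- by rewrite gt0_muley ?lte_fin//= gt0_muleNy ?lte_fin.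
- by rewrite gt0_muley ?lte_fin//= gt0_muleNy ?lte_fin.
Qed.

Section dyadic.
Context {R : realType}.
Implicit Types (b y v e r : R).

Lemma powRV r e : 0 <= r -> r^-1 `^ e = r `^ (- e).
Proof. by move=> r0; rewrite -powR_inv1// -powRrM mulN1r. Qed.

Lemma powR_half r e : 0 <= r -> (r / 2) `^ e = 2 `^ (- e) * r `^ e.
Proof.
by move=> r0; rewrite powRM ?invr_ge0// mulrC powRV.
Qed.

(* A combination of indicators of [v < 2^(k+1) y] comparable with [max y v ^ -b]:
   integrals of radial functions then only see the measures of balls. *)
Fixpoint dyadic_sum n b y v : R :=
  if n is n'.+1 then (if v < 2 * y then y `^ (- b) else 0) + dyadic_sum n' b (2 * y) v
  else 0.

Lemma dyadic_sum_ge0 n b y v : 0 <= dyadic_sum n b y v.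
Proof.
elim: n y => [//|n IH] y /=; rewrite addr_ge0//.
by case: ifP => _ //; exact: powR_ge0.
Qed.

(** If v < 2 y the first term suffices; otherwise max(y, v) is unchanged when y is doubled. The last
    summand accounts for the distances beyond 2^n y and vanishes as n grows. *)
Lemma dyadic_sum_ge n b y v : 0 <= b -> 0 < y ->
  Num.max y v `^ (- b) <= dyadic_sum n b y v + (2 ^+ n * y) `^ (- b).
Proof.
move=> b0; elim: n y => [|n IH] y y0 /=.
  by rewrite expr0 mul1r add0r ler_powRN// le_max lexx.
have y20 : 0 < 2 * y by rewrite mulr_gt0.
rewrite exprSr -mulrA -addrA; case: ltP => [v2|v2].
  rewrite -[leLHS]addr0 lerD// ?addr_ge0 ?dyadic_sum_ge0 ?powR_ge0//.
  by rewrite ler_powRN// le_max lexx.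
rewrite add0r; apply: le_trans (IH _ y20).
by rewrite ler_powRN ?lt_max ?y20// ge_max !le_max v2 lexx !orbT.
Qed.

Lemma powR2N_lt1 b : 0 < b -> 2 `^ (- b) < 1 :> R.
Proof.
move=> b0; rewrite powRN invf_lt1 ?powR_gt0//.
have : 1 `^ b < 2 `^ b :> R by apply: gt0_ltr_powR; rewrite ?nnegrE ?ltr1n.
by rewrite powR1.
Qed.

(** Only the scales beyond v contribute, so the sum is a geometric series that starts near max(y,
    v)^(-b). The factor 2^b covers a start that is off by at most a factor 2. *)
Lemma dyadic_sum_le b : 0 < b -> exists C, 0 < C /\
  forall n y v, 0 < y -> dyadic_sum n b y v <= C * Num.max y v `^ (- b).
Proof.
move=> b0.
have q1 := powR2N_lt1 b0.
have q0 : 0 < 1 - 2 `^ (- b) :> R by rewrite subr_gt0.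
pose C0 : R := (1 - 2 `^ (- b))^-1.
have C00 : 0 < C0 by rewrite invr_gt0.
(* The whole series started at y, with v ignored; this is good enough at the first scale beyond
   v. *)
have S0 n y v : 0 < y -> dyadic_sum n b y v <= C0 * y `^ (- b).
  elim: n y => [|n IH] y y0 /=; first by rewrite mulr_ge0 ?powR_ge0 ?ltW.
  have {}IH := IH (2 * y) (mulr_gt0 (ltr0Sn _ 1) y0).
  have -> : C0 * y `^ (- b) = y `^ (- b) + C0 * (2 * y) `^ (- b).
    rewrite powRM ?ltW// /C0; field; lra.
  by rewrite lerD//; case: ifP => // _; exact: powR_ge0.
exists (2 `^ b * C0); split; first by rewrite mulr_gt0 ?powR_gt0.
elim=> [|n IH] y v y0 /=; first by rewrite !mulr_ge0 ?powR_ge0 ?ltW.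
case: ltP => [v2|v2].
  apply: (@le_trans _ _ (C0 * y `^ (- b))).
    have := S0 n.+1 y v y0; rewrite /= ifT//.
  rewrite (mulrC (2 `^ b)) -mulrA ler_wpM2l ?(ltW C00)//.
  apply: ler_powRN_scale; [exact: ltW|by []|by rewrite lt_max y0|].
  by rewrite ge_max (ltW v2) andbT; lra.
have -> : Num.max y v = Num.max (2 * y) v.
  have yv : y <= v by apply: le_trans v2; lra.
  by rewrite !max_r.
by rewrite add0r; apply: IH; rewrite mulr_gt0.
Qed.

End dyadic.

(** On a space of finite mass the lower bound can only hold up to some radius [r0], whereas the
    upper bound extends to all radii once the constant is enlarged. *)
Record ahlfors_bounds {R : realType} {X : pmetricType R}
    (m : set (borel X) -> \bar R) (Q C1 C2 r0 : R) : Prop := AhlforsBounds {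
  ahlfors_second_countable : @second_countable X;
  ahlfors_dim_gt0 : 0 < Q;
  ahlfors_low_gt0 : 0 < C1;
  ahlfors_up_gt0 : 0 < C2;
  ahlfors_rad_gt0 : 0 < r0;
  ahlfors_low : forall (x : X) (r : R), 0 < r -> r <= r0 ->
    ((C1 * r `^ Q)%:E <= m (ball x r))%E;
  ahlfors_up : forall (x : X) (r : R), 0 < r -> (m (ball x r) <= (C2 * r `^ Q)%:E)%E }.

(** * The Poisson weight *)

Section poisson_weight.
Context {R : realType} {X : pmetricType R}.
Variable m : {finite_measure set (borel X) -> \bar R}.
Variable Q : R.
Hypothesis Q0 : 0 < Q.

Let mball := @measurable_ball_borel R X.
Let coef (k : nat) : R := (2 `^ ((Q + 1) * k%:R))^-1.
Let coef_gt0 k : 0 < coef k. Proof. by rewrite invr_gt0 powR_gt0. Qed.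

Let term_ge0 (x z : X) (y : R) k :
  (0 <= (\1_(ball x (2 ^+ k * y)) z / 2 `^ ((Q + 1) * k%:R))%:E)%E.
Proof. by rewrite lee_fin divr_ge0 ?powR_ge0. Qed.

Let term_measurable (x : X) (y : R) k : measurable_fun setT
  (fun z : borel X => (\1_(ball x (2 ^+ k * y)) (z : X) / 2 `^ ((Q + 1) * k%:R))%:E).
Proof.
by apply/measurable_EFinP; apply: measurable_funM.
Qed.

Lemma poisson_weight_ge0 (x z : X) (y : R) : (0 <= poisson_weight Q x y z)%E.
Proof.
rewrite /poisson_weight mule_ge0//; first by rewrite lee_fin invr_ge0 powR_ge0.
by apply: nneseries_ge0 => k _ _; exact: term_ge0.
Qed.

Lemma measurable_poisson_weight (x : X) (y : R) :
  measurable_fun setT (fun z : borel X => poisson_weight Q x y (z : X)).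
Proof.
rewrite /poisson_weight; apply: measurable_funeM.
apply: (@ge0_emeasurable_sum _ _ _ setT (fun k (z : borel X) =>
  (\1_(ball x (2 ^+ k * y)) (z : X) / 2 `^ ((Q + 1) * k%:R))%:E) xpredT) => //.
Qed.

Lemma integral_poisson_weight (x : X) (y : R) (g : borel X -> \bar R) :
  measurable_fun setT g -> (forall z, (0 <= g z)%E) ->
  (\int[m]_z (poisson_weight Q x y z * g z) = ((y `^ Q)^-1)%:E *
   \sum_(0 <= k <oo) (coef k)%:E * \int[m]_(z in ball x (2 ^+ k * y)) g z)%E.
Proof.
move=> mg g0; pose t k (z : borel X) : \bar R :=
  (\1_(ball x (2 ^+ k * y)) (z : X) / 2 `^ ((Q + 1) * k%:R))%:E.
have mt k : measurable_fun setT (fun z => g z * t k z)%E.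
  by apply: emeasurable_funM => //; exact: term_measurable.
have t0 k z : (0 <= g z * t k z)%E by rewrite mule_ge0//; exact: term_ge0.
transitivity (\int[m]_z (((y `^ Q)^-1)%:E * \sum_(0 <= k <oo) (g z * t k z)))%E.
  apply: eq_integral => z _; rewrite /poisson_weight -muleA; congr (_ * _)%E.
  rewrite muleC; move: (g z) (g0 z) => [r|_|//].
    by move=> _; rewrite nneseriesZl// => k _; exact: term_ge0.
  (* Where [g] is infinite it cannot be treated as a real scalar: both sides are 0 if all terms
     vanish, and +oo otherwise. This occurs for the Riesz kernel on the diagonal. *)
  have [pos|npos] := pselect (exists k, (0 < t k z)%E); last first.
    have t00 k : t k z = 0%E.
      apply/eqP; rewrite eq_le term_ge0 andbT leNgt; apply/negP => tk.
      by apply: npos; exists k.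
    rewrite (eseries0 (f := fun k => t k z)) ?mule0; last by move=> k _ _; exact: t00.
    by rewrite eseries0// => k _ _; rewrite t00 mule0.
  have [k tk] := pos.
  rewrite (nneseries_pinfty (u_ := fun j => (+oo * t j z)%E) (k := k))//; last 2 first.
  - by move=> j _; rewrite mule_ge0//; exact: term_ge0.
  - by rewrite gt0_mulye.
  rewrite gt0_mulye//; apply: lt_le_trans tk _.
  have := nneseries_lim_ge (u_ := fun k => t k z) (P := xpredT) (m := 0%N) k.+1
    (fun n _ _ => term_ge0 x z y n).
  apply: le_trans; rewrite big_nat_recr//= leeDr// sume_ge0// => i _.
  exact: term_ge0.
rewrite ge0_integralZl//.
- congr (_ * _)%E; rewrite integral_nneseries//; apply: eq_eseriesr => k _.
  rewrite [in RHS]integral_mkcond -ge0_integralZl//; last 3 first.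
  - by apply/(measurable_restrictT _ _).1 => //; exact: measurable_funTS.
  - by move=> z _; exact: erestrict_ge0.
  - by rewrite lee_fin ltW.
  apply: eq_integral => z _; rewrite patchE /t indicE.
  have [Bz|nBz] := pselect (ball x (2 ^+ k * y) z).
    by rewrite !mem_set// mul1r muleC.
  by rewrite !memNset// mul0r !mule0.
- apply: (@ge0_emeasurable_sum _ _ _ setT (fun k z => g z * t k z)%E xpredT) => //.
- by move=> z _; apply: nneseries_ge0.
- by rewrite lee_fin invr_ge0 powR_ge0.
Qed.

(** The ratio left over when the coefficient 2^(-(Q+1)k), the volume growth 2^(Qk) and an allowance
    2^(k/2) are multiplied. *)
Let q : R := 2 `^ (- (2^-1)).
Let q0 : 0 < q. Proof. by rewrite powR_gt0. Qed.
Let q1 : q < 1. Proof. by apply: powR2N_lt1; rewrite invr_gt0. Qed.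

Lemma pow2_half_ge1 k : 1 <= (2 ^+ k) `^ (2^-1) :> R.
Proof.
have : (2 ^+ k) `^ 0 <= (2 ^+ k) `^ (2^-1) :> R.
  by rewrite ler_powR ?invr_ge0// exprn_ege1// ler1n.
by rewrite powRr0.
Qed.

Definition geometric_factor : R := (1 - 2 `^ (- (2^-1)))^-1.
Local Notation K := geometric_factor.

Lemma geometric_factor_ge1 : 1 <= K.
Proof. by rewrite /K invf_ge1 ?subr_gt0// gerBl ltW. Qed.

Lemma geometric_nneseries_le (B : R) (u : nat -> \bar R) : 0 <= B ->
  (forall k, (0 <= u k)%E) -> (forall k, (u k <= (B * q ^+ k)%:E)%E) ->
  (\sum_(0 <= k <oo) u k <= (B * K)%:E)%E.
Proof.
move=> B0 u0 uq; apply: lime_le; first exact: is_cvg_nneseries.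
apply: nearW => n; suff : (\sum_(0 <= k < n) u k <= (B * (K - K * q ^+ n))%:E)%E.
  move=> h; apply: le_trans h _; rewrite lee_fin ler_wpM2l// gerBl.
  by rewrite mulr_ge0 ?exprn_ge0 ?ltW// (lt_le_trans ltr01 geometric_factor_ge1).
elim: n => [|n IH]; first by rewrite big_geq// expr0 mulr1 subrr mulr0.
rewrite big_nat_recr//=; apply: le_trans (leeD IH (uq n)) _.
rewrite -EFinD lee_fin -mulrDr ler_wpM2l// exprS le_eqVlt; apply/orP; left; apply/eqP.
rewrite /K -/q; field; by rewrite gt_eqF // subr_gt0.
Qed.

(* The room left by the factor [(2^k)^(1/2)] is what makes the mass of the weight
   away from [x] tend to 0 with [y]. *)
Lemma poisson_weight_integral_le (B : R) (x : X) (y : R) (g : borel X -> \bar R) :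
  0 <= B -> 0 < y -> measurable_fun setT g -> (forall z, (0 <= g z)%E) ->
  (forall k, (\int[m]_(z in ball x (2 ^+ k * y)) g z <=
     (B * (2 ^+ k * y) `^ Q * (2 ^+ k) `^ (2^-1))%:E)%E) ->
  (\int[m]_z (poisson_weight Q x y z * g z) <= (B * K)%:E)%E.
Proof.
move=> B0 y0 mg g0 hB; rewrite integral_poisson_weight//.
have yQ : 0 < y `^ Q by rewrite powR_gt0.
have -> : B * K = (y `^ Q)^-1 * (B * y `^ Q * K) by field; rewrite gt_eqF.
rewrite EFinM; apply: lee_EFinMl; first by rewrite invr_ge0 ltW.
apply: geometric_nneseries_le; first by rewrite mulr_ge0// ltW.
  by move=> k; rewrite mule_ge0 ?lee_fin ?(ltW (coef_gt0 k))//; exact: integral_ge0.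
move=> k; apply: (@le_trans _ _ ((coef k)%:E *
   (B * (2 ^+ k * y) `^ Q * (2 ^+ k) `^ (2^-1))%:E)%E).
  by apply: lee_EFinMl => //; exact: ltW.
rewrite -EFinM lee_fin powRM ?exprn_ge0 ?(ltW y0)// le_eqVlt; apply/orP; left; apply/eqP.
have -> : q ^+ k = coef k * ((2 ^+ k) `^ Q * (2 ^+ k) `^ (2^-1)).
  have two0 e : (e == 0) ==> (2 != 0 :> R) by rewrite pnatr_eq0 implybT.
  rewrite /q /coef -powRN -!powR_mulrn ?powR_ge0// -!powRrM -!powRD ?two0//.
  by congr (_ `^ _); field.
by ring.
Qed.

Lemma poisson_weight_fin_num (x z : X) (y : R) : poisson_weight Q x y z \is a fin_num.
Proof.
rewrite ge0_fin_numE ?poisson_weight_ge0// /poisson_weight.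
apply: (@le_lt_trans _ _ (((y `^ Q)^-1)%:E * (1 * K)%:E)%E); last by rewrite -EFinM ltry.
apply: lee_EFinMl; first by rewrite invr_ge0 powR_ge0.
apply: geometric_nneseries_le => // k.
rewrite lee_fin mul1r; apply: (@le_trans _ _ (coef k)).
  have i1 : (\1_(ball x (2 ^+ k * y)) z : R) <= 1.
    by rewrite indicE; case: (_ \in _); rewrite ?ler01.
  by rewrite -[leRHS]mul1r; apply: ler_wpM2r i1; exact: ltW (coef_gt0 k).
rewrite /coef -powRN /q -powR_mulrn ?powR_ge0// -powRrM ler_powR ?ler1n//.
rewrite mulNr lerN2 ler_wpM2r//; apply: (@le_trans _ _ 1).
  by rewrite invf_le1// ler1n.
by rewrite lerDr ltW.
Qed.

End poisson_weight.

(** * Estimates on Ahlfors regular spaces *)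

Section ahlfors.
Context {R : realType} {X : pmetricType R}.
Variable m : {finite_measure set (borel X) -> \bar R}.
Variables Q C1 C2 r0 : R.
Hypothesis ah : ahlfors_bounds m Q C1 C2 r0.

Let sc := ahlfors_second_countable ah.
Let Q0 := ahlfors_dim_gt0 ah.
Let C10 := ahlfors_low_gt0 ah.
Let C20 := ahlfors_up_gt0 ah.
Let r00 := ahlfors_rad_gt0 ah.
Let low := ahlfors_low ah.
Let upp := ahlfors_up ah.
Let mball := @measurable_ball_borel R X.
Let mtk b y x : measurable_fun setT (fun u : borel X => (trunc_kernel b y x (u : X))%:E).
Proof. by apply/measurable_EFinP; exact: measurable_trunc_kernel. Qed.
Local Hint Resolve mball mtk : core.

(** Regularity compares balls regardless of their centers. Beyond [r0], where the lower bound is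
    lost, the total mass is compared with the mass of a ball of radius [r0]. *)
Lemma ball_measure_doubling (c : R) : 0 < c -> exists Cd, 0 < Cd /\
  forall (x x' : X) (r : R), 0 < r -> (m (ball x (c * r)) <= Cd%:E * m (ball x' r))%E.
Proof.
move=> c0; pose M := fine (m setT).
have M0 : 0 <= M by exact/fine_ge0/measure_ge0.
have D0 : 0 < C1 * r0 `^ Q by rewrite mulr_gt0 ?powR_gt0.
have CC0 : 0 < C2 * c `^ Q / C1 by rewrite divr_gt0 ?mulr_gt0 ?powR_gt0.
have MM0 : 0 <= M / (C1 * r0 `^ Q) by rewrite divr_ge0// ltW.
exists (C2 * c `^ Q / C1 + M / (C1 * r0 `^ Q)).
split=> [|x x' r rgt0]; first by rewrite ltr_pwDl.
have [rr0|rr0] := leP r r0.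
  apply: (@le_trans _ _ (((C2 * c `^ Q / C1)%:E * (C1 * r `^ Q)%:E)%E)).
    have -> : ((C2 * c `^ Q / C1)%:E * (C1 * r `^ Q)%:E = (C2 * (c * r) `^ Q)%:E)%E.
      rewrite -EFinM powRM ?ltW//; congr EFin; field; exact: lt0r_neq0.
    by apply: upp; rewrite mulr_gt0.
  apply: lee_pmul; rewrite ?lee_fin//; last exact: low.
  - exact: ltW.
  - by rewrite mulr_ge0 ?powR_ge0// ltW.
  - by rewrite lerDl.
apply: (@le_trans _ _ (((M / (C1 * r0 `^ Q))%:E * (C1 * r0 `^ Q)%:E)%E)).
  rewrite -EFinM divfK ?gt_eqF// fineK ?fin_num_measure//.
  by apply: le_measure; rewrite ?inE.
apply: lee_pmul; rewrite ?lee_fin//.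
- exact: ltW.
- by rewrite lerDr ltW.
- apply: le_trans (low x' r00 (lexx _)) _.
  apply: le_measure; rewrite ?inE//; apply: le_ball; exact: ltW.
Qed.

(* Halving the radius: with [q = 2^(a-Q) < 1] the constant [C] satisfies
   [2^a C2 + C q = C], and the induction stops at radius [y]. *)
Lemma trunc_kernel_local (a : R) : 0 <= a -> a < Q -> exists C, 0 <= C /\
  forall (y : R) (u : X) (r : R), 0 < y -> 0 < r ->
  (\int[m]_(z in ball u r) (trunc_kernel a y u (z : X))%:E <= (C * r `^ (Q - a))%:E)%E.
Proof.
move=> a0 aQ; pose q : R := 2 `^ (a - Q).
have q0 : 0 < q by rewrite powR_gt0.
have q1 : q < 1.
  by rewrite /q -opprB powR2N_lt1// subr_gt0.
have a1 : 1 <= 2 `^ a :> R by rewrite -[leLHS](powRr0 2) ler_powR// ler1n.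
pose C := 2 `^ a * C2 / (1 - q).
have C20' : C2 <= C.
  rewrite /C ler_pdivlMr ?subr_gt0//.
  apply: (@le_trans _ _ (C2 * 1)); first by rewrite ler_pM2l// gerBl ltW.
  by rewrite mulrC ler_pM2r.
have C0 : 0 <= C by exact: le_trans (ltW C20) C20'.
exists C; split=> // y u r y0.
have rpow t : 0 < t -> t `^ (Q - a) = t `^ (- a) * t `^ Q.
  by move=> t0; rewrite addrC powRD// (gt_eqF t0) implybT.
have [n ryn] : exists n, r <= 2 ^+ n * y.
  have : r / y < 2 ^+ Num.bound (r / y).
    by apply: upper_nthrootP; rewrite leqnn.
  rewrite ltr_pdivrMr// => /ltW h; by exists (Num.bound (r / y)).
elim: n r ryn => [|n IH] r.
  rewrite expr0 mul1r => ry r_gt0.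
  apply: le_trans (ge0_integral_le_cst m (c := y `^ (- a)) _ _ _ _) _ => //.
  - by move=> z; rewrite lee_fin ltW// trunc_kernel_gt0.
  - by move=> z _; rewrite lee_fin trunc_kernel_le.
  apply: (@le_trans _ _ ((r `^ (- a))%:E * (C2 * r `^ Q)%:E)%E).
    apply: lee_pmul => //; rewrite ?lee_fin ?powR_ge0//.
      by rewrite ler_powRN.
    exact: upp.
  rewrite -EFinM lee_fin rpow// mulrCA ler_wpM2r//.
  by rewrite mulr_ge0 ?powR_ge0.
move=> ryn r_gt0.
have r2 : 0 < r / 2 by rewrite divr_gt0.
have {}IH : (\int[m]_(z in ball u (r / 2)) (trunc_kernel a y u (z : X))%:E <=
    (C * (r / 2) `^ (Q - a))%:E)%E.
  by apply: IH => //; rewrite ler_pdivrMr// mulrAC -exprSr.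
apply: (@le_trans _ _ (\int[m]_(z in ball u r `\` ball u (r / 2))
    (trunc_kernel a y u (z : X))%:E + \int[m]_(z in ball u (r / 2))
    (trunc_kernel a y u (z : X))%:E)%E).
  apply: ge0_integral_setU_le => //; first exact: measurableD.
    by move=> z uz; have [|] := pselect (ball u (r / 2) z); [right|left].
  by move=> z; rewrite lee_fin ltW// trunc_kernel_gt0.
have outer : (\int[m]_(z in ball u r `\` ball u (r / 2))
    (trunc_kernel a y u (z : X))%:E <= ((r / 2) `^ (- a) * (C2 * r `^ Q))%:E)%E.
  apply: le_trans (ge0_integral_le_cst m (c := (r / 2) `^ (- a)) _ _ _ _) _ => //.
  - exact: measurableD.
  - by move=> z; rewrite lee_fin ltW// trunc_kernel_gt0.
  - move=> z [_]; rewrite mem_ballE => /negP; rewrite -leNgt => uz.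
    by rewrite lee_fin ler_powRN// le_max uz orbT.
  apply: (@le_trans _ _ (((r / 2) `^ (- a))%:E * m (ball u r))%E).
    apply: lee_EFinMl; first exact: powR_ge0.
    apply: le_measure; rewrite ?inE//; first exact: measurableD.
  by apply: lee_EFinMl (upp u r_gt0); exact: powR_ge0.
apply: le_trans (leeD outer IH) _.
rewrite -EFinD lee_fin !powR_half ?(ltW r_gt0)// opprK opprB rpow//.
rewrite -/q /C le_eqVlt; apply/orP; left; apply/eqP; field; lra.
Qed.

Variables p p' s : R.
Hypotheses (p1 : 1 < p) (pp' : p^-1 + p'^-1 = 1) (s0 : 0 < s) (s1 : s < 1).
Let a := Q * s.
Let p0 : 0 < p. Proof. exact: lt_trans p1. Qed.
Let p'0 : 0 < p'.
Proof. by rewrite -invr_gt0 -[p'^-1](addKr p^-1) pp' addrC subr_gt0 invf_lt1. Qed.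
Let pMp' : p * p' = p + p'.
Proof.
have : p * p' * (p^-1 + p'^-1) = p * p' by rewrite pp' mulr1.
by move=> <-; field; rewrite !gt_eqF.
Qed.
Let p'1 : 1 < p'.
Proof. by rewrite -invf_lt1// -[p'^-1](addKr p^-1) pp' addrC gtrBl invr_gt0. Qed.
Let a0 : 0 < a. Proof. exact: mulr_gt0. Qed.
Let aQ : a < Q. Proof. by rewrite /a -[ltRHS]mulr1 ltr_pM2l. Qed.

Variable Psi : R.
Hypothesis Psi1 : 1 <= Psi.
Let Psi0 : 0 < Psi. Proof. exact: lt_le_trans Psi1. Qed.

Let trk (y : R) (x : X) (u : borel X) : R := trunc_kernel a y x (u : X).
Let mtrk y x : measurable_fun setT (trk y x).
Proof. exact: measurable_trunc_kernel. Qed.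
Let trk_ge0 y x u : 0 <= trk y x u. Proof. exact: powR_ge0. Qed.

(** * From the truncated kernels to the Riesz kernel *)

Lemma riesz_kernel_ge0 (x u : X) : (0 <= riesz_kernel Q s x u)%E.
Proof. by rewrite /riesz_kernel; case: ifP => // _; rewrite lee_fin powR_ge0. Qed.

Lemma riesz_kernelC (x u : X) : riesz_kernel Q s x u = riesz_kernel Q s u x.
Proof. by rewrite /riesz_kernel eq_sym metric_sym. Qed.

Lemma trunc_kernel_cvg (x u : X) :
  (trunc_kernel a n.+1%:R^-1 x u)%:E @[n --> \oo] --> riesz_kernel Q s x u.
Proof.
rewrite /riesz_kernel -/a; case: eqVneq => [<-|xu].
- apply/cvgeyPge => A; near=> n.
  rewrite /trunc_kernel mdistxx max_l// lee_fin powRV// opprK.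
  have An : `|A| `^ a^-1 <= n%:R by near: n; exact: nbhs_infty_ger.
  apply: le_trans (ler_norm A) _.
  have -> : `|A| = (`|A| `^ a^-1) `^ a by rewrite -powRrM mulVf ?lt0r_neq0// powRr1.
  apply: ge0_ler_powR; rewrite ?nnegrE ?powR_ge0 ?ler0n ?(ltW a0)//.
  by apply: le_trans An _; rewrite ler_nat.
- rewrite -mdist_gt0 in xu; apply: cvg_near_cst; near=> n.
  rewrite /trunc_kernel max_r//.
  have xun : (mdist x u)^-1 <= n%:R by near: n; exact: nbhs_infty_ger.
  rewrite invf_ple ?posrE//; apply: le_trans xun _; by rewrite ler_nat.
Unshelve. all: by end_near. Qed.

Lemma ler_trunc_kernel (y y' : R) (x u : X) : 0 < y -> y <= y' ->
  trunc_kernel a y' x u <= trunc_kernel a y x u.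
Proof.
move=> y0 yy; rewrite ler_powRN ?(ltW a0)// ?lt_max ?y0//.
by rewrite ge_max !le_max yy lexx orbT.
Qed.

Lemma trunc_kernel_le_riesz (y : R) (x u : X) : 0 < y ->
  ((trunc_kernel a y x u)%:E <= riesz_kernel Q s x u)%E.
Proof.
move=> y0; rewrite /riesz_kernel -/a; case: eqVneq => [_|xu]; first exact: leey.
by rewrite lee_fin ler_powRN ?(ltW a0)// ?mdist_gt0// le_max lexx orbT.
Qed.

(** Monotone convergence: the truncated kernels increase as the scale shrinks. Bounds that are
    uniform in the scale thus pass to the Riesz kernel. *)
Lemma integral_trunc_kernel_cvg (D : set (borel X)) (w : borel X -> R) (x : X) :
  measurable D -> measurable_fun setT w -> (forall u, 0 <= w u) ->
  (\int[m]_(u in D) (trunc_kernel a n.+1%:R^-1 x (u : X) * w u)%:E)%E @[n --> \oo] -->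
  (\int[m]_(u in D) (riesz_kernel Q s x u * (w u)%:E))%E.
Proof.
move=> mD mw w0.
pose g n (u : borel X) := (trunc_kernel a n.+1%:R^-1 x (u : X) * w u)%:E.
have gcvg u : g n u @[n --> \oo] --> (riesz_kernel Q s x u * (w u)%:E)%E.
  rewrite /g; under eq_fun do rewrite EFinM.
  by apply: cvgeZr => //; exact: trunc_kernel_cvg.
rewrite [X in _ --> X](_ : _ = \int[m]_(u in D) limn (g ^~ u))%E; last first.
  by apply: eq_integral => u _; apply/esym/cvg_lim => //; exact: gcvg.
apply: cvg_monotone_convergence => //.
- move=> n; apply: measurable_funTS; apply/measurable_EFinP.
  by apply: measurable_funM => //; exact: measurable_trunc_kernel.
- by move=> n u _; rewrite lee_fin mulr_ge0// ltW// trunc_kernel_gt0.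
- move=> u _ n k nk; rewrite lee_fin ler_wpM2r// ler_trunc_kernel//.
  by rewrite lef_pV2 ?posrE// ler_nat.
Qed.

Lemma riesz_kernel_local : exists C, 0 <= C /\ forall (u : X) (r : R), 0 < r ->
  (\int[m]_(z in ball u r) riesz_kernel Q s u z <= (C * r `^ (Q - a))%:E)%E.
Proof.
have [C [C0 hC]] := trunc_kernel_local (ltW a0) aQ.
exists C; split=> // u r rgt0.
have m1 : measurable_fun setT (cst 1 : borel X -> R) by exact: measurable_cst.
have := @integral_trunc_kernel_cvg (ball u r) _ u (mball u r) m1 (fun=> ler01).
rewrite [X in _ --> X -> _](_ : _ = \int[m]_(z in ball u r) riesz_kernel Q s u z)%E; last first.
  by apply: eq_integral => z _; rewrite /= mule1.
move=> h; rewrite -(cvg_lim _ h)//; apply: lime_le; first exact: (cvgP _ h).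
apply: nearW => n.
have y0 : 0 < n.+1%:R^-1 :> R by rewrite invr_gt0 ltr0n.
apply: le_trans (hC _ u r y0 rgt0).
by rewrite le_eqVlt; apply/orP; left; apply/eqP/eq_integral => z _; rewrite /= mulr1.
Qed.

(** The singularity is integrable because [Q s < Q], and beyond distance 1 the kernel is at most 1
    on a space of finite mass. The summand 1 makes the constant positive. *)
Lemma riesz_kernel_integral : exists C, 0 < C /\ forall u : X,
  (\int[m]_z riesz_kernel Q s u z <= C%:E)%E.
Proof.
have mrk (x : X) : measurable_fun setT (fun u : borel X => riesz_kernel Q s x (u : X)).
  by apply: measurable_riesz_kernel.
have [C [C0 hC]] := riesz_kernel_local.
exists (1 + C + fine (m setT)); split=> [|u].
  by rewrite ltr_wpDr ?fine_ge0 ?measure_ge0// ltr_wpDr.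
apply: (@le_trans _ _ (\int[m]_(z in ball u 1) riesz_kernel Q s u z +
    \int[m]_(z in ~` ball u 1) riesz_kernel Q s u z)%E).
  apply: ge0_integral_setU_le => //; first exact: measurableC.
    by move=> z _; have [|] := pselect (ball u 1 z); [left|right].
  by move=> z; exact: riesz_kernel_ge0.
rewrite !EFinD leeD//.
  apply: le_trans (hC u 1 ltr01) _.
  by rewrite powR1 mulr1 -EFinD lee_fin lerDr.
apply: le_trans (ge0_integral_le_cst m (c := 1) _ _ _ _) _ => //.
- exact: measurableC.
- by move=> z; exact: riesz_kernel_ge0.
- move=> z; rewrite /= mem_ballE => /negP; rewrite -leNgt => uz.
  rewrite /riesz_kernel; case: eqVneq uz => [->|_ uz].
    by rewrite mdistxx ler10.
  rewrite lee_fin -/a; apply: le_trans (ler_powRN (ltW a0) ltr01 uz) _.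
  by rewrite powR1.
- rewrite mul1e fineK ?fin_num_measure//.
  by apply: le_measure; rewrite ?inE//; exact: measurableC.
Qed.

(** For b >= Q, as for the energy exponent [Q s p'] when s >= 1/p', these integrals may blow up as y
    tends to 0, so two centers are compared instead of bounding either side. [dyadic_sum] reduces
    the comparison to balls of equal radius, up to an error that vanishes as the number of scales
    grows. *)
Lemma trunc_kernel_comparison (b : R) : 0 < b -> exists C, 0 < C /\
  forall (y : R) (x x0 : X), 0 < y ->
  (\int[m]_u (trunc_kernel b y x (u : X))%:E <=
   C%:E * \int[m]_u (trunc_kernel b y x0 (u : X))%:E)%E.
Proof.
move=> b0; have [Cd [Cd0 hCd]] := ball_measure_doubling ltr01.
have [C [C0 hC]] := dyadic_sum_le b0.
have mS n y (x : X) : measurable_fun setT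
    (fun u : borel X => (dyadic_sum n b y (mdist x (u : X)))%:E).
  apply/measurable_EFinP; elim: n y => [|n IH] y //=.
  apply: measurable_funD => //; apply: measurable_fun_ifT => //.
  by apply: measurable_fun_ltr => //; exact: measurable_mdist.
have Scomp n y (x x0 : X) : 0 < y ->
  (\int[m]_u (dyadic_sum n b y (mdist x (u : X)))%:E <=
  Cd%:E * \int[m]_u (dyadic_sum n b y (mdist x0 (u : X)))%:E)%E.
  elim: n y => [|n IH] y y0 /=; first by rewrite !integral0 mule0.
  have step (z : X) : (\int[m]_u (((if mdist z (u : X) < 2 * y then y `^ (- b) else 0) +
      dyadic_sum n b (2 * y) (mdist z (u : X)))%R)%:E =
      (y `^ (- b))%:E * m (ball z (2 * y)) +
      \int[m]_u (dyadic_sum n b (2 * y) (mdist z (u : X)))%:E)%E.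
    under eq_integral do rewrite EFinD.
    rewrite ge0_integralD//.
    - congr (_ + _)%E.
      under eq_integral => u _.
        have -> : ((if mdist z (u : X) < 2 * y then y `^ (- b) else 0)%:E =
            (y `^ (- b))%:E * (\1_(ball z (2 * y)) (u : X))%:E)%E.
          rewrite indicE; case: ifPn => h.
            by rewrite mem_set ?mule1//= mem_ballE.
          by rewrite memNset ?mule0//= mem_ballE; exact/negP.
        over.
      rewrite ge0_integralZl ?lee_fin ?powR_ge0//.
      - by rewrite integral_indic// setIT.
      - by apply/measurable_EFinP; exact: measurable_indic.
    - by move=> u _; case: ifP => // _; rewrite lee_fin powR_ge0.
    - apply/measurable_EFinP; apply: measurable_fun_ifT => //.
      by apply: measurable_fun_ltr => //; exact: measurable_mdist.
    - by move=> u _; rewrite lee_fin dyadic_sum_ge0.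
  rewrite !step muleDr//; last first.
    apply: ge0_adde_def; rewrite inE.
      by rewrite mule_ge0// lee_fin powR_ge0.
    by apply: integral_ge0 => u _; rewrite lee_fin dyadic_sum_ge0.
  apply: leeD; last by apply: IH; rewrite mulr_gt0.
  rewrite muleCA; apply: lee_EFinMl; first exact: powR_ge0.
  by rewrite -[X in ball x X]mul1r; apply: hCd; rewrite mulr_gt0.
exists (Cd * C); split=> [|y x x0 y0]; first exact: mulr_gt0.
have tk0 z u : (0 <= (trunc_kernel b y z u)%:E)%E by move=> *; rewrite lee_fin ltW// trunc_kernel_gt0.
have up n : (\int[m]_u (trunc_kernel b y x (u : X))%:E <=
  (Cd * C)%:E * \int[m]_u (trunc_kernel b y x0 (u : X))%:E +
  (fine (m setT) * (y `^ (- b)) * ((2 `^ (- b)) ^+ n))%:E)%E.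
  apply: (@le_trans _ _ (\int[m]_u ((dyadic_sum n b y (mdist x (u : X)))%:E +
      ((2 ^+ n * y) `^ (- b))%:E))%E).
    apply: ge0_le_integral => //.
      exact: emeasurable_funD.
    by move=> u _; rewrite -EFinD lee_fin dyadic_sum_ge// ltW.
  rewrite ge0_integralD//; last 2 first.
  - by move=> u _; rewrite lee_fin dyadic_sum_ge0.
  - by move=> u _; rewrite lee_fin powR_ge0.
  rewrite integral_cst//; apply: leeD.
    apply: le_trans (Scomp n y x x0 y0) _.
    rewrite EFinM -muleA; apply: lee_EFinMl; first exact: ltW.
    rewrite -ge0_integralZl ?lee_fin ?(ltW C0)//.
    apply: ge0_le_integral => //.
    - by move=> u _; rewrite lee_fin dyadic_sum_ge0.
    - exact: measurable_funeM.
    - by move=> u _; rewrite -EFinM lee_fin hC.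
  rewrite -[X in (_ * X <= _)%E]fineK ?fin_num_measure// -EFinM lee_fin.
  have -> : (2 ^+ n * y) `^ (- b) = (2 `^ (- b)) ^+ n * y `^ (- b).
    rewrite powRM ?exprn_ge0 ?(ltW y0)//; congr (_ * _).
    by rewrite -[RHS]powR_mulrn ?powR_ge0// -powRrM mulrC powRrM powR_mulrn.
  by rewrite le_eqVlt; apply/orP; left; apply/eqP; ring.
have cv : ((Cd * C)%:E * \int[m]_u (trunc_kernel b y x0 (u : X))%:E +
  (fine (m setT) * (y `^ (- b)) * ((2 `^ (- b)) ^+ n))%:E)%E @[n --> \oo] -->
  ((Cd * C)%:E * \int[m]_u (trunc_kernel b y x0 (u : X))%:E + 0)%E.
  apply: cvgeD; first by rewrite fin_num_adde_defl.
    exact: cvg_cst.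
  apply: cvg_EFin; first exact: nearW.
  rewrite -[X in _ --> X](mulr0 (fine (m setT) * y `^ (- b))).
  apply: cvgMl_tmp; apply: cvg_expr.
  by rewrite ger0_norm ?powR_ge0// powR2N_lt1.
rewrite -[leRHS]adde0 -(cvg_lim _ cv)//; apply: lime_ge; first exact: (cvgP _ cv).
exact: nearW.
Qed.

(** * Energy of the truncated kernel and capacity of balls *)

Lemma ball_measure_gt0 (x : X) (r : R) : 0 < r -> (0 < m (ball x r))%E.
Proof.
move=> rgt0; have m0 : 0 < Num.min r r0 by rewrite lt_min rgt0 r00.
apply: (@lt_le_trans _ _ (C1 * (Num.min r r0) `^ Q)%:E).
  by rewrite lte_fin mulr_gt0 ?powR_gt0.
apply: le_trans (low x m0 _) _; first by rewrite ge_min lexx orbT.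
by apply: le_measure; rewrite ?inE//; apply: le_ball; rewrite ge_min lexx.
Qed.

Lemma riesz_kernel_ge_trunc (c y : R) (x x0 u : X) : 0 < c ->
  mdist x u <= c * Num.max y (mdist x0 u) ->
  ((trunc_kernel a y x0 u / c `^ a)%:E <= riesz_kernel Q s x u)%E.
Proof.
move=> c0 xu; rewrite /riesz_kernel -/a; case: eqVneq => [_|]; first exact: leey.
rewrite -mdist_gt0 => d0; rewrite lee_fin ler_pdivrMr ?powR_gt0// mulrC.
by apply: ler_powRN_scale xu; rewrite ?(ltW a0).
Qed.

(* The p'-th power of the L^p' norm of the truncated kernel of exponent [Q s]. *)
Definition kernel_energy (y : R) (x : X) : R :=
  fine (\int[m]_u (trunc_kernel (a * p') y x (u : X))%:E).
Local Notation G := kernel_energy.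

Lemma kernel_energyE (y : R) (x : X) : 0 < y ->
  (\int[m]_u (trunc_kernel (a * p') y x (u : X))%:E = (G y x)%:E)%E.
Proof.
move=> y0; rewrite fineK// ge0_fin_numE; last first.
  by apply: integral_ge0 => u _; rewrite lee_fin ltW// trunc_kernel_gt0.
apply: (@le_lt_trans _ _ ((y `^ (- (a * p')))%:E * m setT)%E).
  apply: ge0_integral_le_cst => //.
  - by move=> u; rewrite lee_fin ltW// trunc_kernel_gt0.
  - by move=> u _; rewrite lee_fin trunc_kernel_le// mulr_ge0// ltW.
by rewrite -[X in (_ * X)%E]fineK ?fin_num_measure// -EFinM ltry.
Qed.

Lemma kernel_energy_gt0 (y : R) (x : X) : 0 < y -> 0 < G y x.
Proof.
move=> y0; rewrite -lte_fin -kernel_energyE//.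
apply: (@lt_le_trans _ _ ((y `^ (- (a * p')))%:E * m (ball x y))%E).
  by rewrite mule_gt0 ?ball_measure_gt0// lte_fin powR_gt0.
apply: (@le_trans _ _ (\int[m]_(u in ball x y) (trunc_kernel (a * p') y x (u : X))%:E)%E).
  apply: ge0_cst_le_integral => //; first exact: powR_ge0.
  by move=> u; rewrite mem_ballE => xu; rewrite lee_fin /trunc_kernel max_l// ltW.
apply: ge0_subset_integral => //.
by move=> u _; rewrite lee_fin ltW// trunc_kernel_gt0.
Qed.

(* The test function is the extremal of Hoelder's inequality against the truncated
   kernel, a multiple of its power [p' - 1]. *)
Lemma capacity_ball_le (y : R) (x0 : X) : 0 < y ->
  (capacity m Q s p (ball x0 y) <= ((2 `^ a) `^ p * G y x0 `^ (1 - p))%:E)%E.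
Proof.
move=> y0; have g0 := kernel_energy_gt0 x0 y0.
(* Division by the energy normalizes the potential at the center. The factor 2^a pays for moving to
   another point x of the ball, where d(x, u) <= 2 max(y, d(x0, u)). *)
pose c := 2 `^ a / G y x0.
have c0 : 0 < c by rewrite divr_gt0 ?powR_gt0.
pose f (u : borel X) := c * trunc_kernel (a * (p' - 1)) y x0 (u : X).
have f0 u : 0 <= f u by rewrite mulr_ge0 ?powR_ge0// ltW.
have mf : measurable_fun setT f.
  by apply: measurable_funM => //; exact: measurable_trunc_kernel.
have Ef : (\int[m]_u (`|f u| `^ p)%:E = ((2 `^ a) `^ p * G y x0 `^ (1 - p))%:E)%E.
  transitivity (\int[m]_u ((c `^ p)%:E * (trunc_kernel (a * p') y x0 (u : X))%:E))%E.
    apply: eq_integral => u _; rewrite ger0_norm// /f powRM ?powR_ge0 ?(ltW c0)//.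
    rewrite trunc_kernel_exp EFinM; congr (_ * (trunc_kernel _ _ _ _)%:E)%E.
    rewrite -mulrA; congr (_ * _).
    have -> : (p' - 1) * p = p * p' - p by ring.
    by rewrite pMp' addrAC subrr add0r.
  rewrite ge0_integralZl ?lee_fin ?powR_ge0//; last first.
    by move=> u _; rewrite lee_fin ltW// trunc_kernel_gt0.
  rewrite kernel_energyE// -EFinM /c powRM ?invr_ge0 ?powR_ge0 ?(ltW g0)//.
  rewrite powRV ?(ltW g0)// -mulrA -{2}[G y x0]powRr1 ?(ltW g0)//.
  by rewrite -powRD ?(gt_eqF g0) ?implybT// (addrC (- p)).
have Nf : ('N[m]_p%:E[EFin \o f] `^ p = ((2 `^ a) `^ p * G y x0 `^ (1 - p))%:E)%E.
  rewrite poweR_Lnorm ?gt_eqF// -Ef.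
rewrite -Nf; apply: ereal_inf_lbound => /=; exists f => //; split.
  rewrite inE; apply/andP; split; first by rewrite inE.
  rewrite inE /finite_norm/=.
  have := ltry ((2 `^ a) `^ p * G y x0 `^ (1 - p)); rewrite -Nf.
  by apply: lty_poweRy; rewrite gt_eqF.
move=> x; rewrite mem_ballE => x0x.
apply: (@le_trans _ _ (\int[m]_u (((G y x0)^-1)%:E *
    (trunc_kernel (a * p') y x0 (u : X))%:E))%E).
  rewrite ge0_integralZl ?lee_fin ?invr_ge0 ?(ltW g0)//; last first.
    by move=> u _; rewrite lee_fin ltW// trunc_kernel_gt0.
  by rewrite kernel_energyE// -EFinM mulVf ?gt_eqF.
rewrite /riesz_potential; apply: ge0_le_integral => //.
- by move=> u _; rewrite -EFinM lee_fin mulr_ge0 ?invr_ge0 ?(ltW g0)// ltW// trunc_kernel_gt0.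
- exact: measurable_funeM.
- apply: emeasurable_funM; first exact: measurable_riesz_kernel.
  exact/measurable_EFinP.
move=> u _.
apply: (@le_trans _ _ ((trunc_kernel a y x0 (u : X) / 2 `^ a)%:E * (f u)%:E)%E).
  rewrite -!EFinM lee_fin /f /c le_eqVlt; apply/orP; left; apply/eqP.
  have -> : a * p' = a + a * (p' - 1) by ring.
  have -> : trunc_kernel (a + a * (p' - 1)) y x0 u =
      trunc_kernel a y x0 u * trunc_kernel (a * (p' - 1)) y x0 u.
    rewrite /trunc_kernel opprD powRD//.
    by rewrite (gt_eqF (_ : 0 < Num.max _ _)) ?implybT// lt_max y0.
  by field; rewrite !gt_eqF// powR_gt0.
apply: lee_wpmul2r; first by rewrite lee_fin.
apply: riesz_kernel_ge_trunc => //.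
apply: le_trans (metric_triangle x x0 u) _; rewrite (metric_sym x).
have : y <= Num.max y (mdist x0 u) by rewrite le_max lexx.
have : mdist x0 u <= Num.max y (mdist x0 u) by rewrite le_max lexx orbT.
by move: x0x; lra.
Qed.

(* A real radius adapted to [x], so that no case distinction on an infinite
   [eta_star] is needed. *)
Lemma approach_radius (y : R) (x0 x : X) : 0 < y ->
  eball x0 (Psi%:E * eta_star m Q s p x0 y) x ->
  exists rho, [/\ y <= rho, mdist x0 x <= Psi * rho &
    rho = y \/ (m (ball x0 rho) < capacity m Q s p (ball x0 y))%E].
Proof.
move=> y0 xPsi.
exists (Num.max y (mdist x0 x / Psi)); split.
- by rewrite le_max lexx.
- by rewrite mulrC -ler_pdivrMr// le_max lexx orbT.
(* If d(x0, x) / Psi exceeds y, membership in the region puts it strictly below [eta]. It is then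
   not admissible in that infimum, which is the strict inequality. *)
have [dy|yd] := leP (mdist x0 x / Psi) y; [by left|right].
rewrite ltNge; apply/negP => capm.
have : (Defs.eta m Q s p x0 y <= (mdist x0 x / Psi)%:E)%E.
  by apply: ereal_inf_lbound; exists (mdist x0 x / Psi) => //; split=> //; exact: lt_trans yd.
move=> etad; move: xPsi; rewrite /eball/= ltNge => /negP; apply.
apply: (@le_trans _ _ (Psi%:E * (mdist x0 x / Psi)%:E)%E); last first.
  by rewrite -EFinM mulrC divfK ?gt_eqF.
apply: lee_EFinMl; first exact: ltW.
by rewrite ge_max etad andbT lee_fin ltW.
Qed.

(** When [rho] is given by the capacity, [capacity_ball_le] applies. For [rho = y], all but one
    factor of exponent a = Q s is estimated by its maximum, so G <= CK y^(-a (p'-1)). As (p-1)(p'-1)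
    = 1, this gives G^(p-1) <= CK^(p-1) y^(-a), and y^(Q-a) <= 1 for y <= 1. *)
Lemma ball_measure_energy : exists C, 0 < C /\ forall (x0 : X) (y rho : R),
  0 < y -> y <= 1 ->
  rho = y \/ (m (ball x0 rho) < capacity m Q s p (ball x0 y))%E ->
  (m (ball x0 rho) <= (C * G y x0 `^ (1 - p))%:E)%E.
Proof.
have [CK [CK0 hCK]] := riesz_kernel_integral.
pose A1 := (2 `^ a) `^ p; pose A2 := C2 * CK `^ (p - 1).
have A10 : 0 < A1 by rewrite powR_gt0// powR_gt0.
have A20 : 0 < A2 by rewrite mulr_gt0// powR_gt0.
exists (A1 + A2); split=> [|x0 y rho y0 y1 [->|mcap]]; first exact: addr_gt0.
- have g0 := kernel_energy_gt0 x0 y0.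
  apply: le_trans (upp _ y0) _; rewrite lee_fin.
  apply: (@le_trans _ _ (A2 * G y x0 `^ (1 - p))); last first.
    by rewrite ler_wpM2r ?powR_ge0// lerDr ltW.
  rewrite /A2 -mulrA ler_pM2l//.
  have gle : G y x0 <= CK * y `^ (- (a * (p' - 1))).
    rewrite -lee_fin -kernel_energyE//.
    apply: (@le_trans _ _ (\int[m]_u ((y `^ (- (a * (p' - 1))))%:E *
        riesz_kernel Q s x0 u))%E).
      apply: ge0_le_integral => //.
      - by move=> u _; rewrite lee_fin ltW// trunc_kernel_gt0.
      - by apply: measurable_funeM; exact: measurable_riesz_kernel.
      move=> u _; apply: (@le_trans _ _ ((y `^ (- (a * (p' - 1))))%:E * (trk y x0 u)%:E)%E).
        rewrite -EFinM lee_fin.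
        have -> : a * p' = a * (p' - 1) + a by ring.
        have -> : trunc_kernel (a * (p' - 1) + a) y x0 u =
            trunc_kernel (a * (p' - 1)) y x0 u * trk y x0 u.
          rewrite /trk /trunc_kernel opprD powRD//.
          by rewrite (gt_eqF (_ : 0 < Num.max _ _)) ?implybT// lt_max y0.
        by rewrite ler_wpM2r// trunc_kernel_le// mulr_ge0 ?subr_ge0 ?(ltW p'1) ?(ltW a0).
      by apply: lee_EFinMl; [exact: powR_ge0|exact: (trunc_kernel_le_riesz)].
    rewrite ge0_integralZl ?lee_fin ?powR_ge0//.
    - by rewrite (mulrC CK) EFinM; apply: lee_EFinMl; [exact: powR_ge0|exact: hCK].
    - exact: measurable_riesz_kernel.
    - by move=> u _; exact: riesz_kernel_ge0.
  have p1gt0 : 0 < p - 1 by rewrite subr_gt0.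
  have gp : G y x0 `^ (p - 1) <= CK `^ (p - 1) * y `^ (- a).
    apply: (@le_trans _ _ ((CK * y `^ (- (a * (p' - 1)))) `^ (p - 1))).
      by apply: ge0_ler_powR; rewrite ?nnegrE ?mulr_ge0 ?powR_ge0 ?(ltW g0) ?(ltW CK0) ?(ltW p1gt0).
    rewrite powRM ?powR_ge0 ?(ltW CK0)// -powRrM.
    have -> : - (a * (p' - 1)) * (p - 1) = - a * (p * p' - (p + p') + 1) by ring.
    by rewrite pMp' subrr add0r mulr1.
  rewrite -(opprB p 1) powRN ler_pdivlMr ?powR_gt0//.
  apply: (@le_trans _ _ (y `^ Q * (CK `^ (p - 1) * y `^ (- a)))).
    by rewrite ler_wpM2l ?powR_ge0.
  rewrite mulrCA -[leRHS]mulr1 ler_wpM2l ?powR_ge0//.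
  rewrite -powRD ?(gt_eqF y0) ?implybT//.
  apply: (@le_trans _ _ (1 `^ (Q - a))); last by rewrite powR1.
  by apply: ge0_ler_powR; rewrite ?nnegrE ?subr_ge0 ?(ltW aQ) ?(ltW y0).
- apply: (le_trans (ltW mcap)); apply: le_trans (capacity_ball_le x0 y0) _.
  by rewrite lee_fin -/A1 ler_wpM2r ?powR_ge0// lerDl ltW.
Qed.

(** * The weak type inequality for the truncated potential *)

Section potential_on_set.
Variables (h : borel X -> R) (D : set (borel X)).
Hypotheses (mh : measurable_fun setT h) (mD : measurable D).

Let mhp : measurable_fun setT (fun u => `|h u| `^ p).
Proof.
by apply: (measurableT_comp (measurable_powR p)); exact: measurableT_comp.
Qed.

Let indic_powR (u : borel X) q : 0 < q -> (\1_D u : R) `^ q = \1_D u.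
Proof.
by move=> q0; rewrite indicE; case: (_ \in _); rewrite ?powR1// powR0// gt_eqF.
Qed.

(** The restriction to [D] is put on [h], so that the kernel contributes its full energy, which is
    comparable between centers. *)
Lemma near_potential (y : R) (x : X) : 0 < y ->
  ((\int[m]_(u in D) (trk y x u * `|h u|)%:E) `^ p <=
   (G y x `^ (p - 1))%:E * \int[m]_(u in D) (`|h u| `^ p)%:E)%E.
Proof.
move=> y0.
have := @hoelder_pow _ _ _ m (fun u => `|h u| * \1_D u) (trk y x) p p' _ _ p1 pp'.
have -> : (\int[m]_u (`| `|h u| * \1_D u * trk y x u |)%:E =
    \int[m]_(u in D) (trk y x u * `|h u|)%:E)%E.
  rewrite [in RHS]integral_mkcond; apply: eq_integral => u _.
  rewrite ger0_norm ?mulr_ge0// patchE indicE; case: ifPn => uD.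
    by rewrite mulr1 mulrC.
  by rewrite mulr0 mul0r.
have -> : (\int[m]_u (`| `|h u| * \1_D u| `^ p)%:E =
    \int[m]_(u in D) (`|h u| `^ p)%:E)%E.
  rewrite [in RHS]integral_mkcond; apply: eq_integral => u _.
  rewrite ger0_norm ?mulr_ge0// powRM// indic_powR// patchE indicE; case: ifPn => uD.
    by rewrite mulr1.
  by rewrite mulr0.
have -> : (\int[m]_u (`|trk y x u| `^ p')%:E = (G y x)%:E)%E.
  rewrite -(kernel_energyE x y0); apply: eq_integral => u _.
  by rewrite ger0_norm// trunc_kernel_exp.
rewrite muleC; apply => //.
by apply: measurable_funM => //; exact: measurableT_comp.
Qed.

(** Hoelder's inequality for the kernel split into its powers 1/p and 1/p': the second factor
    contributes the mass of the kernel, at most [CK], and one copy of the kernel stays with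
    |h|^p. *)
Lemma far_potential CK (y : R) (x : X) : 0 < y -> 0 < CK ->
  (\int[m]_u riesz_kernel Q s x u <= CK%:E)%E ->
  ((\int[m]_(u in D) (trk y x u * `|h u|)%:E) `^ p <=
   (CK `^ (p - 1))%:E * \int[m]_(u in D) (trk y x u * `|h u| `^ p)%:E)%E.
Proof.
move=> y0 CK0 hCK.
have m1 : measurable_fun setT (fun u => trk y x u `^ p^-1 * (`|h u| * \1_D u)).
  apply: measurable_funM; first exact: (measurableT_comp (measurable_powR _)).
  by apply: measurable_funM => //; exact: measurableT_comp.
have m2 : measurable_fun setT (fun u => trk y x u `^ p'^-1).
  exact: (measurableT_comp (measurable_powR _)).
have := hoelder_pow m m1 m2 p1 pp'.
have -> : (\int[m]_u (`| trk y x u `^ p^-1 * (`|h u| * \1_D u) * trk y x u `^ p'^-1 |)%:E =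
    \int[m]_(u in D) (trk y x u * `|h u|)%:E)%E.
  rewrite [in RHS]integral_mkcond; apply: eq_integral => u _.
  rewrite ger0_norm ?mulr_ge0 ?powR_ge0// mulrAC -powRD; last first.
    by rewrite pp' oner_eq0.
  by rewrite pp' powRr1// patchE indicE; case: ifPn => uD; rewrite ?mulr1// !mulr0.
have -> : (\int[m]_u (`| trk y x u `^ p^-1 * (`|h u| * \1_D u)| `^ p)%:E =
    \int[m]_(u in D) (trk y x u * `|h u| `^ p)%:E)%E.
  rewrite [in RHS]integral_mkcond; apply: eq_integral => u _.
  rewrite ger0_norm ?mulr_ge0 ?powR_ge0// powRM ?mulr_ge0 ?powR_ge0//.
  rewrite -powRrM mulVf ?gt_eqF// powRr1// powRM// indic_powR// patchE indicE.
  by case: ifPn => uD; rewrite ?mulr1// !mulr0.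
move=> H; apply: le_trans H _.
rewrite muleC; apply: lee_wpmul2r.
  by apply: integral_ge0 => u _; rewrite lee_fin mulr_ge0 ?powR_ge0.
rewrite -poweR_EFin; apply: gt0_ler_poweR; first by rewrite subr_ge0 ltW.
- by rewrite in_itv/= leey andbT; apply: integral_ge0 => u _; rewrite lee_fin powR_ge0.
- by rewrite in_itv/= leey lee_fin ltW.
apply: le_trans hCK; apply: ge0_le_integral => //.
- apply/measurable_EFinP; apply: (measurableT_comp (measurable_powR _)).
  by apply: measurableT_comp.
- exact: measurable_riesz_kernel.
- move=> u _; rewrite ger0_norm ?powR_ge0// -powRrM mulVf ?gt_eqF// powRr1//.
  exact: (trunc_kernel_le_riesz).
Qed.

End potential_on_set.

Lemma measure_ball_fine (x : X) (r : R) : (m (ball x r) = (fine (m (ball x r)))%:E)%E.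
Proof. by rewrite fineK// fin_num_measure. Qed.

(* The first integral bounds the part of the potential coming from
   [B(x0, (Psi + 1) rho)] (Hoelder), the second the rest of it (Jensen). *)
Lemma level_ball_le : exists C, 0 < C /\
  forall (h : borel X -> R) (x0 x : X) (y rho lam : R), measurable_fun setT h ->
  0 < y -> y <= 1 -> y <= rho -> mdist x0 x <= Psi * rho ->
  rho = y \/ (m (ball x0 rho) < capacity m Q s p (ball x0 y))%E ->
  0 <= lam -> (lam%:E < \int[m]_u (trk y x u * `|h u|)%:E)%E ->
  ((lam `^ p)%:E * m (ball x0 rho) <=
   C%:E * (\int[m]_(u in ball x0 ((Psi + 1) * rho)) (`|h u| `^ p)%:E +
     \int[m]_(u in ~` ball x0 ((Psi + 1) * rho))
       (fine (m (ball x0 rho)) * (trk y x u * `|h u| `^ p))%:E))%E.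
Proof.
have [CK [CK0 hCK]] := riesz_kernel_integral.
have [C3 [C30 hC3]] := ball_measure_energy.
have ap' : 0 < a * p' by rewrite mulr_gt0.
have [C4 [C40 hC4]] := trunc_kernel_comparison ap'.
have p1gt0 : 0 < p - 1 by rewrite subr_gt0.
(* [CN] bounds m(B(x0, rho)) G(x, y)^(p-1), where C4 is the price of replacing x0 by x; [CF] is the
   constant of the far part. The factor 2^p appears because only one of the two parts is known to
   reach lam / 2. *)
pose CN := C3 * C4 `^ (p - 1); pose CF := CK `^ (p - 1).
have CN0 : 0 < CN by rewrite mulr_gt0 ?powR_gt0.
have CF0 : 0 < CF by rewrite powR_gt0.
exists (2 `^ p * (CN + CF)); split; first by rewrite mulr_gt0 ?powR_gt0 ?addr_gt0.
move=> h x0 x y rho lam mh y0 y1 yrho dx hrho lam0 lamlt.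
have mhp : measurable_fun setT (fun u => `|h u| `^ p).
  by apply: (measurableT_comp (measurable_powR p)); exact: measurableT_comp.
set B : set (borel X) := ball x0 ((Psi + 1) * rho); set mu := fine (m (ball x0 rho)).
have mB : measurable B by exact: mball.
have mBc : measurable (~` B) by exact: measurableC.
have mu0 : 0 <= mu by rewrite fine_ge0.
rewrite [m (ball x0 rho)]measure_ball_fine -/mu.
set N := (\int[m]_(u in B) (`|h u| `^ p)%:E)%E.
have N0 : (0 <= N)%E by apply: integral_ge0 => u _; rewrite lee_fin powR_ge0.
set F := (\int[m]_(u in ~` B) (mu * _)%:E)%E.
have F0 : (0 <= F)%E.
  by apply: integral_ge0 => u _; rewrite lee_fin !mulr_ge0 ?powR_ge0.
have lamE : lam `^ p = 2 `^ p * (lam / 2) `^ p.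
  rewrite powRM ?invr_ge0// mulrCA -powRM ?invr_ge0//.
  by rewrite mulfV// powR1 mulr1.
have split_pot : ((lam / 2)%:E <= \int[m]_(u in B) (trk y x u * `|h u|)%:E)%E \/
    ((lam / 2)%:E <= \int[m]_(u in ~` B) (trk y x u * `|h u|)%:E)%E.
  apply/orP; rewrite -[X in X || _]negbK -[X in _ || X]negbK -negb_and -!ltNge.
  apply/negP => /andP[hN hF]; move: lamlt; apply/negP; rewrite -leNgt.
  apply: (@le_trans _ _ (\int[m]_(u in B) (trk y x u * `|h u|)%:E +
      \int[m]_(u in ~` B) (trk y x u * `|h u|)%:E)%E).
    apply: ge0_integral_setU_le => //.
    - by move=> u _; have [|] := pselect (B u); [left|right].
    - by apply/measurable_EFinP; apply: measurable_funM => //; exact: measurableT_comp.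
    - by move=> u; rewrite lee_fin mulr_ge0.
  apply: le_trans (leeD (ltW hN) (ltW hF)) _.
  by rewrite -EFinD lee_fin -splitr.
have lam2 : (lam / 2)%:E%E \in `[0%E, +oo%E].
  by rewrite in_itv/= leey lee_fin divr_ge0.
have pos D : (\int[m]_(u in D) (trk y x u * `|h u|)%:E)%E \in `[0%E, +oo%E].
  by rewrite in_itv/= leey andbT integral_ge0// => u _; rewrite lee_fin mulr_ge0.
rewrite lamE -EFinM -mulrA [X in (_ <= X)%E](_ : _ =
   (2 `^ p)%:E * ((CN + CF)%:E * (N + F)))%E; last by rewrite EFinM muleA.
rewrite EFinM; apply: lee_EFinMl; first exact: powR_ge0.
rewrite EFinM muleC.
case: split_pot => /(gt0_ler_poweR (ltW p0) lam2 (pos _)); rewrite poweR_EFin => hl.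
- apply: (@le_trans _ _ (CN%:E * N)%E); last first.
    by apply: lee_pmul => //; rewrite ?lee_fin ?lerDl ?leeDl ?(ltW CN0) ?(ltW CF0).
  apply: (@le_trans _ _ (mu%:E * ((G y x `^ (p - 1))%:E * N))%E).
    apply: lee_EFinMl => //; apply: le_trans hl _.
    exact: (near_potential mh mB).
  rewrite muleA; apply: lee_wpmul2r => //; rewrite -EFinM lee_fin.
  have gx := kernel_energy_gt0 x y0.
  have gx0 := kernel_energy_gt0 x0 y0.
  have Gle : G y x <= C4 * G y x0.
    have := hC4 y x x0 y0.
    by rewrite (kernel_energyE x y0) (kernel_energyE x0 y0).
  have mule : mu <= C3 * G y x0 `^ (1 - p).
    by rewrite -lee_fin -measure_ball_fine; exact: hC3 hrho.
  apply: (@le_trans _ _ ((C3 * G y x0 `^ (1 - p)) * (C4 * G y x0) `^ (p - 1))).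
    apply: ler_pM; rewrite ?powR_ge0//.
    apply: (ge0_ler_powR (ltW p1gt0) _ _ Gle); rewrite nnegrE; first exact: ltW gx.
    exact: mulr_ge0 (ltW C40) (ltW gx0).
  rewrite powRM ?(ltW C40) ?(ltW gx0)// -(opprB p 1) powRN /CN.
  by rewrite le_eqVlt; apply/orP; left; apply/eqP; field; rewrite gt_eqF// powR_gt0.
- apply: (@le_trans _ _ (CF%:E * F)%E); last first.
    by apply: lee_pmul => //; rewrite ?lee_fin ?lerDr ?leeDr ?(ltW CN0) ?(ltW CF0).
  have FE : (F = mu%:E * \int[m]_(u in ~` B) (trk y x u * `|h u| `^ p)%:E)%E.
    rewrite /F; under eq_integral do rewrite EFinM.
    rewrite ge0_integralZl//.
    - apply: measurable_funTS; apply/measurable_EFinP.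
      exact: measurable_funM.
    - by move=> u _; rewrite lee_fin mulr_ge0 ?powR_ge0.
  rewrite FE muleCA; apply: lee_EFinMl => //; apply: le_trans hl _.
  exact: (far_potential mh mBc).
Qed.

(* Replaces the far part, multiplied by [m (B(x0, rho))], by an integral over
   [B(x0, rho)], which can be summed over disjoint balls. *)
Lemma far_kernel_le (x0 x u : X) (y rho : R) : 0 < y -> y <= rho ->
  mdist x0 x <= Psi * rho -> ~ ball x0 ((Psi + 1) * rho) u ->
  ((fine (m (ball x0 rho)) * trk y x u)%:E <=
   ((Psi + 2) `^ a)%:E * \int[m]_(z in ball x0 rho) riesz_kernel Q s u z)%E.
Proof.
move=> y0 yrho dx; rewrite mem_ballE => /negP; rewrite -leNgt => dxu.
have P2 : 0 < Psi + 2 by rewrite addr_gt0.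
have pa : 0 < (Psi + 2) `^ a by rewrite powR_gt0.
have -> : (fine (m (ball x0 rho)) * trk y x u)%:E =
    (((Psi + 2) `^ a)%:E * ((trk y x u / (Psi + 2) `^ a)%:E * m (ball x0 rho)))%E.
  rewrite measure_ball_fine -!EFinM; congr EFin; field.
  by rewrite gt_eqF.
apply: lee_EFinMl; first exact: ltW.
apply: ge0_cst_le_integral => //.
- exact: measurable_riesz_kernel.
- by rewrite divr_ge0 ?powR_ge0.
move=> z; rewrite mem_ballE => dz; rewrite riesz_kernelC.
apply: (riesz_kernel_ge_trunc) => //.
apply: (@le_trans _ _ ((Psi + 2) * mdist x u)); last first.
  by rewrite ler_pM2l// le_max lexx orbT.
(* From d(x0, u) >= (Psi + 1) rho and d(x0, x) <= Psi rho follows d(x, u) >= rho. Hence d(z, u) <=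
   rho + Psi rho + d(x, u) <= (Psi + 2) d(x, u). *)
have t1 := metric_triangle z x0 u; have t2 := metric_triangle x0 x u.
rewrite (metric_sym z x0) in t1.
have dxu' : rho <= mdist x u by lra.
have : Psi * rho <= Psi * mdist x u by rewrite ler_pM2l.
lra.
Qed.

(** Superlevel set of the maximal function over the approach region. Heights are cut off at 1, as
    [ball_measure_energy] requires; the limit at height 0 does not see this. *)
Definition level_set (h : borel X -> R) (lam : R) : set X :=
  [set x0 | exists x y, [/\ 0 < y, y <= 1,
    eball x0 (Psi%:E * eta_star m Q s p x0 y)%E x &
    (lam%:E < \int[m]_u (trunc_kernel (Q * s) y x (u : X) * `|h u|)%:E)%E]].

(** The enlarged balls are the ones made disjoint: this sums the near parts directly, and the far
    parts through the smaller concentric balls. Doubling by the factor 3 (Psi + 1) returns from the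
    tripled enlarged balls to the small ones. *)
Lemma weak_type : exists C, 0 < C /\ forall (h : borel X -> R) (lam : R),
  measurable_fun setT h -> 0 < lam ->
  exists U : set (borel X), [/\ measurable U, level_set h lam `<=` U &
    (m U <= (C / lam `^ p)%:E * \int[m]_u (`|h u| `^ p)%:E)%E].
Proof.
have [CK [CK0 hCK]] := riesz_kernel_integral.
have [C [C0 hC]] := level_ball_le.
have La0 : 0 < Psi + 1 by rewrite addr_gt0.
have [Cd [Cd0 hCd]] := ball_measure_doubling (mulr_gt0 (ltr0Sn R 2) La0).
pose c := (Psi + 2) `^ a; have c0 : 0 < c by rewrite powR_gt0// addr_gt0.
exists (Cd * C * (1 + c * CK)); split.
  by rewrite !mulr_gt0// addr_gt0// mulr_gt0.
move=> h lam mh lam0.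
have mhp : measurable_fun setT (fun u => `|h u| `^ p).
  by apply: (measurableT_comp (measurable_powR p)); exact: measurableT_comp.
set I := (\int[m]_u (`|h u| `^ p)%:E)%E.
have I0 : (0 <= I)%E by apply: integral_ge0 => u _; rewrite lee_fin powR_ge0.
pose good (e : X) (t : X * R * R) := let: (x, y, rho) := t in
  [/\ 0 < y, y <= rho, mdist e x <= Psi * rho &
    ((lam `^ p)%:E * m (ball e rho) <=
   C%:E * (\int[m]_(u in ball e ((Psi + 1) * rho)) (`|h u| `^ p)%:E +
     \int[m]_(u in ~` ball e ((Psi + 1) * rho))
       (fine (m (ball e rho)) * (trk y x u * `|h u| `^ p))%:E))%E].
have sel (e : X) : exists t, level_set h lam e -> good e t.
  have [[x [y [y0 y1 xy ly]]]|ne] := pselect (level_set h lam e); last first.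
    by exists (e, 0, 0).
  have [rho [yrho dx hrho]] := approach_radius y0 xy.
  exists (x, y, rho) => _; split=> //.
  by apply: hC => //; exact: ltW.
have {sel}[T hT] := choice sel.
pose xs e := (T e).1.1; pose ys e := (T e).1.2; pose rs e := (T e).2.
have {}hT e : level_set h lam e -> good e (xs e, ys e, rs e).
  by rewrite /xs /ys /rs => /hT; case: (T e) => -[].
have rs0 e : level_set h lam e -> 0 < rs e.
  by move=> /hT[y0 yr _ _]; exact: lt_le_trans yr.
apply: (@vitali_cover R X m (level_set h lam) (fun e => (Psi + 1) * rs e)) => //.
- by rewrite mule_ge0// lee_fin !(mulr_ge0, invr_ge0, addr_ge0) ?powR_ge0 ?(ltW Cd0) ?(ltW C0) ?(ltW c0) ?(ltW CK0).
- by move=> e /rs0 r0e; rewrite mulr_gt0.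
move=> D uD DL tD.
pose B e : set (borel X) := ball e (rs e).
pose BL e : set (borel X) := ball e ((Psi + 1) * rs e).
have mB e : measurable (B e) by exact: mball.
have mBL e : measurable (BL e) by exact: mball.
have BBL e : e \in D -> B e `<=` BL e.
  move=> /DL/rs0 r0e; apply: le_ball.
  by rewrite ler_peMl ?(ltW r0e)// lerDr ltW.
have tB : trivIset [set` D] B.
  move=> i j iD jD [z [Bi Bj]]; apply: tD => //.
  by exists z; split; [exact: BBL Bi|exact: BBL Bj].
pose F e u : R := fine (m (B e)) * (trk (ys e) (xs e) u * `|h u| `^ p).
have F0 e u : 0 <= F e u by rewrite !mulr_ge0 ?powR_ge0// fine_ge0.
have mF e : measurable_fun setT (F e).
  by apply: measurable_funM => //; exact: measurable_funM.
have lamp : 0 < lam `^ p by rewrite powR_gt0.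
have sumN : (\sum_(e <- D) \int[m]_(u in BL e) (`|h u| `^ p)%:E <= I)%E.
  rewrite -(@ge0_integral_bigsetU _ _ _ m _ BL (fun u => (`|h u| `^ p)%:E) D)//.
  - apply: ge0_subset_integral => //; first exact: bigsetU_measurable.
    exact/measurable_EFinP.
  - by apply: measurable_funTS; exact/measurable_EFinP.
(* The sum is taken under the integral in u. For fixed u the terms are at most c |h u|^p times
   integrals of the Riesz kernel over the disjoint sets [B e], which together do not exceed [CK]. *)
have sumF : (\sum_(e <- D) \int[m]_(u in ~` BL e) (F e u)%:E <= (c * CK)%:E * I)%E.
  under eq_bigr do rewrite integral_mkcond.
  rewrite -ge0_integral_sum//; last 2 first.
  - move=> e; apply/(measurable_restrictT _ _).1; first exact: measurableC.
    by apply: measurable_funTS; exact/measurable_EFinP.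
  - by move=> e u _; apply: erestrict_ge0 => v _; rewrite lee_fin.
  rewrite -ge0_integralZl ?lee_fin ?mulr_ge0 ?(ltW c0) ?(ltW CK0)//; last first.
    exact/measurable_EFinP.
  apply: ge0_le_integral => //.
  - by move=> u _; apply: sume_ge0 => e _; apply: erestrict_ge0 => v _; rewrite lee_fin.
  - apply: emeasurable_sum => e; apply/(measurable_restrictT _ _).1; first exact: measurableC.
    by apply: measurable_funTS; exact/measurable_EFinP.
  - by apply: measurable_funeM; exact/measurable_EFinP.
  move=> u _.
  apply: (@le_trans _ _ (\sum_(e <- D) (`|h u| `^ p)%:E * (c%:E *
      \int[m]_(z in B e) riesz_kernel Q s u z))%E).
    rewrite big_seq [in leRHS]big_seq; apply: lee_sum => e eD.
    have rk0 : (0 <= \int[m]_(z in B e) riesz_kernel Q s u z)%E.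
      by apply: integral_ge0 => z _; exact: riesz_kernel_ge0.
    rewrite patchE; case: ifPn => [|_]; last first.
      by rewrite !mule_ge0// lee_fin ?powR_ge0// ltW.
    rewrite inE => uBL; have [y0 yr dx _] := hT e (DL e eD).
    rewrite /F mulrA mulrC EFinM; apply: lee_EFinMl; first exact: powR_ge0.
    exact: (far_kernel_le y0 yr dx uBL).
  rewrite -ge0_sume_distrr; last first.
    move=> e _; rewrite mule_ge0// ?lee_fin ?(ltW c0)//.
    by apply: integral_ge0 => z _; exact: riesz_kernel_ge0.
  rewrite -ge0_sume_distrr; last first.
    by move=> e _; apply: integral_ge0 => z _; exact: riesz_kernel_ge0.
  rewrite muleC; apply: lee_wpmul2r; first by rewrite lee_fin powR_ge0.
  rewrite EFinM; apply: lee_EFinMl; first exact: ltW.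
  have mrk : measurable_fun setT (fun z : borel X => riesz_kernel Q s u (z : X)).
    exact: measurable_riesz_kernel.
  rewrite -(@ge0_integral_bigsetU _ _ _ m _ B (fun z => riesz_kernel Q s u z) D)//.
  - apply: le_trans (hCK u); apply: ge0_subset_integral => //.
      exact: bigsetU_measurable.
    by move=> z _; exact: riesz_kernel_ge0.
  - exact: measurable_funTS.
  - by move=> z _; exact: riesz_kernel_ge0.
apply: (@le_trans _ _ (\sum_(e <- D) (Cd * C / lam `^ p)%:E *
   (\int[m]_(u in BL e) (`|h u| `^ p)%:E + \int[m]_(u in ~` BL e) (F e u)%:E))%E).
  rewrite big_seq [in leRHS]big_seq; apply: lee_sum => e eD.
  have [y0 yr dx hlam] := hT e (DL e eD).
  rewrite mulrA; apply: le_trans (hCd e e (rs e) (rs0 e (DL e eD))) _.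
  rewrite -mulrA EFinM -muleA; apply: lee_EFinMl; first exact: ltW.
  rewrite mulrC EFinM -muleA.
  have -> : (m (ball e (rs e)) = ((lam `^ p)^-1)%:E * ((lam `^ p)%:E * m (ball e (rs e))))%E.
    by rewrite muleA -EFinM mulVf ?gt_eqF// mul1e.
  by apply: lee_EFinMl => //; rewrite invr_ge0 ltW.
rewrite -ge0_sume_distrr; last first.
  move=> e _; rewrite adde_ge0//; apply: integral_ge0 => u _; by rewrite lee_fin ?powR_ge0.
rewrite big_split/= [X in (_ <= X)%E](_ : _ =
  (Cd * C / lam `^ p)%:E * (I + (c * CK)%:E * I))%E; last first.
  rewrite -[X in (X + _)%E]mul1e -ge0_muleDl ?lee_fin ?mulr_ge0 ?(ltW c0) ?(ltW CK0)//.
  rewrite -EFinD muleA -EFinM; congr ((_)%:E * _)%E.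
  by rewrite -!mulrA; do 2 congr (_ * _); rewrite mulrC.
apply: lee_EFinMl; first by rewrite !mulr_ge0 ?invr_ge0 ?(ltW Cd0) ?(ltW C0) ?(ltW lamp).
exact: leeD.
Qed.

(** * The Poisson integral of a Riesz potential *)

(** The term k = 0, a ball of radius y, already gives the lower bound, whence the condition on y.
    The normalization becomes a real number not exceeding 1 / C1. *)
Lemma poisson_mass (x : X) (y : R) : 0 < y -> y <= r0 -> exists Z : R,
  [/\ C1 <= Z, (\int[m]_z poisson_weight Q x y z = Z%:E)%E &
   poisson_normalization m Q x y = (Z^-1)%:E].
Proof.
move=> y0 yr0.
have E1 : (\int[m]_z poisson_weight Q x y z = \int[m]_z (poisson_weight Q x y z * 1))%E.
  by apply: eq_integral => z _; rewrite mule1.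
have up : (\int[m]_z poisson_weight Q x y z <= (C2 * geometric_factor)%:E)%E.
  rewrite E1; apply: (poisson_weight_integral_le (g := cst 1%E)) => //; first exact: ltW.
  move=> k; rewrite integral_cst// mul1e.
  have y2 : 0 < 2 ^+ k * y by rewrite mulr_gt0// exprn_gt0.
  apply: le_trans (upp x y2) _.
  rewrite lee_fin -[leLHS]mulr1 ler_wpM2l ?mulr_ge0 ?powR_ge0 ?(ltW C20)//.
  exact: pow2_half_ge1.
have lo : (C1%:E <= \int[m]_z poisson_weight Q x y z)%E.
  rewrite E1 (@integral_poisson_weight _ _ m Q x y (cst 1%E))//.
  apply: (@le_trans _ _ (((y `^ Q)^-1)%:E * m (ball x y))%E).
    have -> : C1%:E = (((y `^ Q)^-1)%:E * (C1 * y `^ Q)%:E)%E.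
      by rewrite -EFinM; congr EFin; field; rewrite gt_eqF// powR_gt0.
    by apply: lee_EFinMl; [rewrite invr_ge0 powR_ge0|exact: low].
  apply: lee_EFinMl; first by rewrite invr_ge0 powR_ge0.
  have := nneseries_lim_ge (u_ := fun k => (((2 `^ ((Q + 1) * k%:R))^-1)%:E *
    \int[m]_(z in ball x (2 ^+ k * y)) cst 1 z)%E) (P := xpredT) (m := 0%N) 1.
  rewrite big_nat1 mulr0 powRr0 invr1 mul1e expr0 mul1r integral_cst// mul1e; apply.
  by move=> k _ _; rewrite mule_ge0 ?lee_fin ?invr_ge0 ?powR_ge0//; exact: integral_ge0.
have fin : (\int[m]_z poisson_weight Q x y z)%E \is a fin_num.
  rewrite ge0_fin_numE; first exact: le_lt_trans up (ltry _).
  by apply: integral_ge0 => z _; exact: poisson_weight_ge0.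
exists (fine (\int[m]_z poisson_weight Q x y z)); split.
- by rewrite -lee_fin fineK.
- by rewrite fineK.
- rewrite /poisson_normalization -[in LHS](fineK fin) inver gt_eqF//.
  by rewrite -lte_fin fineK//; exact: lt_le_trans lo.
Qed.

(** If u is at distance at least 2 r from x, the kernel is at most 2^a d(x, u)^(-a) on the ball,
    with a = Q s. Otherwise the ball lies in B(u, 3 r), and the local integral is a multiple of r^Q
    r^(-a), where r^(-a) is at most 2^a times the truncated kernel. *)
Lemma ball_riesz_kernel_le : exists C, 0 <= C /\ forall (x u : X) (y r : R),
  0 < y -> y <= r -> (\int[m]_(z in ball x r) riesz_kernel Q s z u <=
    (C * r `^ Q * trunc_kernel a y x u)%:E)%E.
Proof.
have [C [C0 hC]] := riesz_kernel_local.
exists (2 `^ a * (C2 + C * 3 `^ (Q - a))); split.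
  by rewrite mulr_ge0 ?powR_ge0// addr_ge0 ?mulr_ge0 ?powR_ge0// ltW.
move=> x u y r y0 yr; have rgt0 : 0 < r by exact: lt_le_trans yr.
under eq_integral do rewrite riesz_kernelC.
have mrk : measurable_fun setT (fun z : borel X => riesz_kernel Q s u (z : X)).
  by apply: measurable_riesz_kernel.
have tk0 : 0 < trunc_kernel a y x u by exact: trunc_kernel_gt0.
have [far|near] := leP (2 * r) (mdist x u).
- have d0 : 0 < mdist x u by apply: lt_le_trans far; rewrite mulr_gt0.
  have tkE : trunc_kernel a y x u = mdist x u `^ (- a).
    by rewrite /trunc_kernel max_r//; apply: le_trans far; lra.
  apply: (@le_trans _ _ ((2 `^ a * trunc_kernel a y x u)%:E * m (ball x r))%E).
    apply: ge0_integral_le_cst => //; first by move=> z; exact: riesz_kernel_ge0.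
    move=> z; rewrite mem_ballE => xz; rewrite /riesz_kernel.
    have zu : mdist x u <= 2 * mdist u z.
      have := metric_triangle x z u; rewrite (metric_sym z); lra.
    case: eqVneq => uz; first by move: zu; rewrite -uz mdistxx mulr0 leNgt d0.
    by rewrite lee_fin tkE; apply: ler_powRN_scale; rewrite ?(ltW a0).
  apply: (@le_trans _ _ ((2 `^ a * trunc_kernel a y x u)%:E * (C2 * r `^ Q)%:E)%E).
    by apply: lee_EFinMl; [rewrite mulr_ge0 ?powR_ge0// ltW|exact: upp].
  rewrite -EFinM lee_fin mulrACA [leLHS]mulrC -subr_ge0.
  have -> : 2 `^ a * (C2 + C * 3 `^ (Q - a)) * r `^ Q * trunc_kernel a y x u -
    trunc_kernel a y x u * r `^ Q * (2 `^ a * C2) =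
    2 `^ a * (C * 3 `^ (Q - a)) * r `^ Q * trunc_kernel a y x u by ring.
  by rewrite !mulr_ge0 ?powR_ge0// ltW.
- apply: (@le_trans _ _ (\int[m]_(z in ball u (3 * r)) riesz_kernel Q s u z)%E).
    apply: ge0_subset_integral => //; first exact: measurable_funTS.
      by move=> z _; exact: riesz_kernel_ge0.
    move=> z; rewrite !mem_ballE => xz.
    by have := metric_triangle u x z; rewrite (metric_sym u x); lra.
  have r3 : 0 < 3 * r by rewrite mulr_gt0.
  apply: le_trans (hC u _ r3) _; rewrite lee_fin.
  rewrite (powRM _ _ (ltW rgt0))//.
  have rr : r `^ (Q - a) = r `^ Q * r `^ (- a).
    by rewrite powRD// (gt_eqF rgt0) implybT.
  have rtk : r `^ (- a) <= 2 `^ a * trunc_kernel a y x u.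
    apply: ler_powRN_scale; rewrite ?(ltW a0)// ?lt_max ?y0//.
    by rewrite ge_max (ltW near) andbT; lra.
  apply: (@le_trans _ _ (C * (3 `^ (Q - a) * (r `^ Q * (2 `^ a * trunc_kernel a y x u))))).
    by rewrite rr !ler_wpM2l ?powR_ge0.
  rewrite -subr_ge0.
  have -> : 2 `^ a * (C2 + C * 3 `^ (Q - a)) * r `^ Q * trunc_kernel a y x u -
    C * (3 `^ (Q - a) * (r `^ Q * (2 `^ a * trunc_kernel a y x u))) =
    2 `^ a * C2 * r `^ Q * trunc_kernel a y x u by ring.
  by rewrite !mulr_ge0 ?powR_ge0// ltW.
Qed.

(** [L] is chosen before [f], so one kernel serves [f] and both of its pieces. It is finite
    everywhere because averaging removes the singularity. *)
Lemma riesz_poisson_kernel : exists C, 0 <= C /\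
  forall (x : X) (y : R), 0 < y -> y <= r0 -> exists L : borel X -> R,
  [/\ measurable_fun setT L, (forall u, 0 <= L u <= C * trunc_kernel a y x (u : X)) &
    forall f : borel X -> R, m.-integrable setT (EFin \o f) ->
    (poisson_integral m Q (riesz_potential m Q s f) (x, y) =
      \int[m]_u (L u * f u)%:E)%E].
Proof.
have [C [C0 hC]] := ball_riesz_kernel_le.
have K0 : 0 <= @geometric_factor R.
  by apply: (@le_trans _ _ 1) => //; exact: geometric_factor_ge1.
have CK0 : 0 <= C * geometric_factor / C1.
  by apply: divr_ge0; [exact: mulr_ge0|exact: ltW].
exists (C * geometric_factor / C1); split=> //.
move=> x y y0 yr0; have [Z [C1Z _ ZE]] := poisson_mass x y0 yr0.
have Z0 : 0 < Z by exact: lt_le_trans C1Z.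
pose w (z : borel X) : R := fine (poisson_weight Q x y z).
have wE (z : borel X) : poisson_weight Q x y z = (w z)%:E by rewrite fineK// poisson_weight_fin_num.
have w0 z : 0 <= w z by rewrite fine_ge0// poisson_weight_ge0.
have mw : measurable_fun setT w.
  apply/measurable_EFinP; apply: eq_measurable_fun (measurable_poisson_weight Q x y).
  by move=> z _; rewrite wE.
pose F0 (v : borel X * borel X) : \bar R :=
  ((w v.1 / Z)%:E * riesz_kernel Q s (v.1 : X) (v.2 : X))%E.
have F00 v : (0 <= F0 v)%E.
  by rewrite mule_ge0 ?riesz_kernel_ge0// lee_fin divr_ge0// ltW.
have mwZ : measurable_fun setT (fun v : borel X * borel X => (w v.1 / Z)%:E).
  apply/measurable_EFinP; apply: measurable_funM => //.
  by apply: (measurableT_comp mw); exact: measurable_fst.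
have mF0 : measurable_fun setT F0.
  by apply: emeasurable_funM => //; exact: measurable_riesz_kernel2.
pose Lb (u : borel X) : \bar R := (\int[m]_z F0 (z, u))%E.
have Lb0 u : (0 <= Lb u)%E by exact: integral_ge0.
have mrk (u : X) : measurable_fun setT (fun z : borel X => riesz_kernel Q s (z : X) u).
  by under eq_fun do rewrite riesz_kernelC; exact: measurable_riesz_kernel.
have Lble u : (Lb u <= (C * geometric_factor / C1 * trunc_kernel a y x (u : X))%:E)%E.
  have tk0 : 0 < trunc_kernel a y x u by exact: trunc_kernel_gt0.
  rewrite /Lb /F0 /=.
  have -> : (\int[m]_z ((w z / Z)%:E * riesz_kernel Q s z u) =
      (Z^-1)%:E * \int[m]_z (poisson_weight Q x y z * riesz_kernel Q s z u))%E.
    rewrite -ge0_integralZl ?lee_fin ?invr_ge0 ?(ltW Z0)//.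
    - by apply: eq_integral => z _; rewrite wE muleA -EFinM mulrC.
    - apply: emeasurable_funM => //; exact: measurable_poisson_weight.
    - by move=> z _; rewrite mule_ge0 ?riesz_kernel_ge0// poisson_weight_ge0.
  apply: (@le_trans _ _ ((Z^-1)%:E * (C * trunc_kernel a y x u * geometric_factor)%:E)%E).
    apply: lee_EFinMl; first by rewrite invr_ge0 ltW.
    apply: poisson_weight_integral_le => //.
    - by rewrite mulr_ge0// ltW.
    - by move=> z; exact: riesz_kernel_ge0.
    - move=> k; have yk : y <= 2 ^+ k * y.
        by rewrite ler_peMl ?(ltW y0)// exprn_ege1// ler1n.
      apply: le_trans (hC x u y _ y0 yk) _; rewrite lee_fin.
      rewrite mulrAC -[leLHS]mulr1 ler_wpM2l ?pow2_half_ge1//.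
      by rewrite !mulr_ge0 ?powR_ge0// ltW.
  rewrite -EFinM lee_fin.
  have -> : C * geometric_factor / C1 * trunc_kernel a y x u =
      C1^-1 * (C * trunc_kernel a y x u * geometric_factor) by ring.
  by rewrite ler_wpM2r ?mulr_ge0 ?(ltW tk0)// lef_pV2.
have LbE u : Lb u = (fine (Lb u))%:E.
  rewrite fineK// ge0_fin_numE//; exact: le_lt_trans (Lble u) (ltry _).
have mLb : measurable_fun setT Lb.
  exact: (measurable_fun_fubini_tonelli_G (m1 := m) F0 mF0 F00).
exists (fine \o Lb); split.
- by apply/measurable_EFinP; apply: eq_measurable_fun mLb => u _; rewrite /= LbE.
- by move=> u /=; rewrite fine_ge0//= -lee_fin -LbE.
move=> f intf; have mf : measurable_fun setT f.
  by apply/measurable_EFinP; exact: measurable_int intf.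
pose F (v : borel X * borel X) : \bar R :=
  ((w v.1 / Z)%:E * (riesz_kernel Q s (v.1 : X) (v.2 : X) * (f v.2)%:E))%E.
have FE v : F v = (F0 v * (f v.2)%:E)%E by rewrite /F muleA.
have mf2 : measurable_fun setT (fun v : borel X * borel X => (f v.2)%:E).
  apply/measurable_EFinP; apply: (measurableT_comp mf); exact: measurable_snd.
have mF : measurable_fun setT F.
  by apply: emeasurable_funM => //; apply: emeasurable_funM => //; exact: measurable_riesz_kernel2.
have mF0u (u : borel X) : measurable_fun setT (fun z => F0 (z, u)).
  exact: (measurableT_comp mF0 (measurable_pair2 u)).
(* Absolute convergence for Fubini's theorem: at fixed y the averaged kernel is bounded by a
   multiple of y^(-a), and [f] is integrable. *)
have intF : (m \x m)%E.-integrable setT F.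
  apply/(integrable21ltyP m m mF).
  apply: (@le_lt_trans _ _ (\int[m]_u ((C * geometric_factor / C1 * y `^ (- a))%:E * `|(f u)%:E|))%E).
    have -> : (\int[m]_u \int[m]_z `|F (z, u)| = \int[m]_u (Lb u * `|(f u)%:E|))%E.
      apply: eq_integral => u _; rewrite /Lb -ge0_integralZr//.
      by apply: eq_integral => z _; rewrite FE abseM (gee0_abs (F00 _)).
    apply: ge0_le_integral => //.
    - by move=> u _; rewrite mule_ge0.
    - by apply: emeasurable_funM => //; apply: measurableT_comp => //; exact/measurable_EFinP.
    - by apply: measurable_funeM; apply: measurableT_comp => //; exact/measurable_EFinP.
    move=> u _; apply: lee_wpmul2r => //; apply: le_trans (Lble u) _.
    rewrite lee_fin ler_wpM2l//.
    by apply: trunc_kernel_le => //; exact: ltW.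
  rewrite ge0_integralZl//; last 2 first.
  - by apply: measurableT_comp => //; exact/measurable_EFinP.
  - by rewrite lee_fin mulr_ge0 ?powR_ge0.
  apply: lte_mul_pinfty; rewrite ?lee_fin//.
    by rewrite mulr_ge0 ?powR_ge0.
  by move/integrableP : intf => [_].
(* The weight enters the inner integral at every [z], including those where the potential of [f]
   diverges; hence [ge0_integralZl_real]. *)
transitivity (\int[m]_z \int[m]_u F (z, u))%E.
  rewrite /poisson_integral /=; apply: eq_integral => z _.
  rewrite ZE wE -EFinM mulrC /riesz_potential -ge0_integralZl_real//.
    by apply: emeasurable_funM; [exact: measurable_riesz_kernel|exact/measurable_EFinP].
  by rewrite divr_ge0// ltW.
rewrite (Fubini intF); apply: eq_integral => u _.
under eq_integral do rewrite FE /=.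
rewrite integralZr//; first by rewrite -/(Lb u) LbE.
apply/integrableP; split=> //.
under eq_integral do rewrite (gee0_abs (F00 _)).
by rewrite -/(Lb u) LbE ltry.
Qed.

(** * The Poisson integral as an approximate identity *)

(** Balls of radius at most d miss the complement. For the others (2^k y / d)^(1/2) >= 1 can be
    inserted, and the allowance (2^k)^(1/2) of [poisson_weight_integral_le] absorbs the growing
    factor. *)
Lemma poisson_tail (x : X) (y d : R) : 0 < y -> 0 < d ->
  (\int[m]_z (poisson_weight Q x y z * (\1_(~` ball x d) z)%:E) <=
   (C2 * geometric_factor * (y / d) `^ (2^-1))%:E)%E.
Proof.
move=> y0 d0; have mB : measurable (~` (ball x d) : set (borel X)) by exact: measurableC.
rewrite (mulrAC C2); apply: poisson_weight_integral_le => //.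
- by rewrite mulr_ge0 ?powR_ge0// ltW.
- by apply/measurable_EFinP; exact: measurable_indic.
move=> k; have r_gt0 : 0 < 2 ^+ k * y by rewrite mulr_gt0// exprn_gt0.
have rhs0 : 0 <= C2 * (y / d) `^ 2^-1 * (2 ^+ k * y) `^ Q * (2 ^+ k) `^ 2^-1.
  by rewrite !mulr_ge0 ?powR_ge0// ltW.
rewrite integral_indic//; have [kd|dk] := leP (2 ^+ k * y) d.
  rewrite (_ : _ `&` _ = set0) ?measure0 ?lee_fin//.
  by apply/seteqP; split=> // z [/=] nz kz; apply: nz; exact: le_ball kz.
apply: (@le_trans _ _ (m (ball x (2 ^+ k * y)))).
  by apply: le_measure; rewrite ?inE//; exact: measurableI.
apply: le_trans (upp x r_gt0) _; rewrite lee_fin.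
have kk : 1 <= (y / d) `^ 2^-1 * (2 ^+ k) `^ 2^-1.
  rewrite -powRM ?divr_ge0 ?exprn_ge0 ?(ltW y0) ?(ltW d0)//.
  have h : 1 <= y / d * 2 ^+ k by rewrite mulrAC ler_pdivlMr// mul1r mulrC ltW.
  have : 1 `^ 2^-1 <= (y / d * 2 ^+ k) `^ 2^-1 :> R.
    by apply: ge0_ler_powR; rewrite ?nnegrE ?invr_ge0// (le_trans _ h).
  by rewrite powR1.
have -> : C2 * (y / d) `^ 2^-1 * (2 ^+ k * y) `^ Q * (2 ^+ k) `^ 2^-1 =
   C2 * (2 ^+ k * y) `^ Q * ((y / d) `^ 2^-1 * (2 ^+ k) `^ 2^-1) by ring.
by rewrite -[leLHS]mulr1 ler_wpM2l// mulr_ge0 ?powR_ge0// ltW.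
Qed.

Definition eps_continuous (g : X -> R) (x0 : X) := forall e, 0 < e ->
  exists2 d, 0 < d & forall z, mdist x0 z < d -> `|g z - g x0| <= e.

(** Convergence is unrestricted here; the approach region matters only for the unbounded remainder
    of f. *)
Lemma poisson_bounded_cvg (g : borel X -> R) (M : R) (x0 : X) :
  measurable_fun setT g -> (forall z, `|g z| <= M) -> eps_continuous g x0 ->
  forall e, 0 < e -> exists2 d, 0 < d & forall (x : X) (y : R), mdist x0 x < d ->
    0 < y -> y < d ->
    exists2 v : R, poisson_integral m Q (EFin \o g) (x, y) = v%:E & `|v - g x0| <= e.
Proof.
move=> mg gM gc e e0; have M0 : 0 <= M by exact: le_trans (gM x0).
have e2 : 0 < e / 2 by rewrite divr_gt0.
have [d d0 gd] := gc _ e2.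
have d20 : 0 < d / 2 by rewrite divr_gt0.
have K0 : 0 < @geometric_factor R.
  by apply: (@lt_le_trans _ _ 1) => //; exact: geometric_factor_ge1.
pose T := 2 * M / C1 * (C2 * geometric_factor).
have T0 : 0 <= T by rewrite !mulr_ge0 ?(ltW K0) ?(ltW C20) ?invr_ge0 ?(ltW C10).
pose t := e / 2 / (T + 1).
have t0 : 0 < t by rewrite divr_gt0// ltr_wpDl.
(* The three bounds keep B(x, d/2) inside B(x0, d), make [poisson_mass] applicable, and give (y /
   (d/2))^(1/2) <= t, so that the tail is at most T t <= e / 2. *)
exists (Num.min (Num.min (d / 2) r0) (d / 2 * t ^+ 2)).
  by rewrite !lt_min d20 r00 mulr_gt0// exprn_gt0.
move=> x y; rewrite !lt_min => /andP[/andP[xd _] _] y0 /andP[/andP[_ yr0] yt].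
have [Z [C1Z mass ZE]] := poisson_mass x y0 (ltW yr0).
have Z0 : 0 < Z by exact: lt_le_trans C1Z.
pose w (z : borel X) : R := fine (poisson_weight Q x y z).
have wE (z : borel X) : poisson_weight Q x y z = (w z)%:E by rewrite fineK// poisson_weight_fin_num.
have w0 z : 0 <= w z by rewrite fine_ge0// poisson_weight_ge0.
have mw : measurable_fun setT w.
  apply/measurable_EFinP; apply: eq_measurable_fun (measurable_poisson_weight Q x y).
  by move=> z _; rewrite wE.
pose k (z : borel X) : R := w z / Z.
have k0 z : 0 <= k z by rewrite divr_ge0// ltW.
have mk : measurable_fun setT k by exact: measurable_funM.
have k1 : (\int[m]_z (k z)%:E = 1)%E.
  transitivity (\int[m]_z ((Z^-1)%:E * (w z)%:E))%E.
    by apply: eq_integral => z _; rewrite -EFinM mulrC.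
  rewrite ge0_integralZl ?lee_fin ?invr_ge0 ?(ltW Z0)//; [|exact/measurable_EFinP|by move=> z _; rewrite lee_fin].
  by under eq_integral do rewrite -wE; rewrite mass -EFinM mulVf ?gt_eqF.
have ik : m.-integrable setT (EFin \o k).
  apply/integrableP; split; first exact/measurable_EFinP.
  under eq_integral do rewrite /= ger0_norm//.
  by rewrite k1 ltry.
have ikg : m.-integrable setT (fun z => (k z * g z)%:E).
  apply: (le_integrable measurableT _ _ (integrableZl measurableT M ik)).
    by apply/measurable_EFinP; exact: measurable_funM.
  move=> z _; rewrite -EFinM /= lee_fin !normrM mulrC ler_wpM2r//.
  by apply: le_trans (gM z) _; exact: ler_norm.
have ikx : m.-integrable setT (fun z => (g x0)%:E * (EFin \o k) z)%E.
  exact: integrableZl.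
have PIE : poisson_integral m Q (EFin \o g) (x, y) = (\int[m]_z (k z * g z)%:E)%E.
  rewrite /poisson_integral /=; apply: eq_integral => z _.
  by rewrite ZE wE -!EFinM /k (mulrC Z^-1).
have fin : (\int[m]_z (k z * g z)%:E)%E \is a fin_num by exact: integrable_fin_num.
exists (fine (\int[m]_z (k z * g z)%:E)); first by rewrite PIE fineK.
rewrite -lee_fin -abse_EFin EFinB fineK//.
have gE : ((g x0)%:E = \int[m]_z ((g x0)%:E * (EFin \o k) z))%E.
  by rewrite integralZl//= k1 mule1.
rewrite [X in (_ - X)%E]gE -integralB//.
apply: le_trans (le_abse_integral _ _ _) _ => //.
  exact: measurable_int (integrableB measurableT ikg ikx).
pose far (z : borel X) : \bar R := (\1_(~` ball x (d / 2)) z)%:E.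
have mfar : measurable_fun setT far.
  by apply/measurable_EFinP; apply: measurable_indic; exact: measurableC.
apply: (@le_trans _ _ (\int[m]_z ((e / 2)%:E * (k z)%:E +
    (2 * M / Z)%:E * (poisson_weight Q x y z * far z)))%E).
  apply: ge0_le_integral => //.
  - apply: measurableT_comp => //.
    exact: measurable_int (integrableB measurableT ikg ikx).
  - apply: emeasurable_funD.
      by apply: measurable_funeM; exact/measurable_EFinP.
    by apply: measurable_funeM; apply: emeasurable_funM => //; exact: measurable_poisson_weight.
  move=> z _; rewrite wE.
  suff : `|k z * g z - g x0 * k z| <=
      e / 2 * k z + 2 * M / Z * (w z * \1_(~` ball x (d / 2)) z).
    by rewrite -lee_fin.
  have -> : k z * g z - g x0 * k z = k z * (g z - g x0) by ring.
  rewrite normrM (ger0_norm (k0 z)) indicE.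
  have [xz|xz] := pselect (ball x (d / 2) z).
    rewrite memNset; last by move=> /(_ xz).
    rewrite !mulr0 addr0 mulrC ler_wpM2r//; apply: gd.
    move: xz; rewrite mem_ballE => xz.
    by have := metric_triangle x0 x z; lra.
  rewrite mem_set// mulr1; apply: (@le_trans _ _ (k z * (2 * M))).
    rewrite ler_wpM2l//; apply: le_trans (ler_normB _ _) _.
    by have := gM z; have := gM x0; lra.
  rewrite -subr_ge0 (_ : _ - _ = e / 2 * k z); first by rewrite mulr_ge0// ltW.
  by rewrite /k; field; rewrite gt_eqF.
rewrite ge0_integralD//; last 4 first.
- by move=> z _; rewrite mule_ge0// lee_fin// ltW.
- by apply: measurable_funeM; exact/measurable_EFinP.
- move=> z _; apply: mule_ge0; first by rewrite lee_fin divr_ge0 ?mulr_ge0// ltW.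
  by rewrite mule_ge0 ?poisson_weight_ge0// lee_fin.
- by apply: measurable_funeM; apply: emeasurable_funM => //; exact: measurable_poisson_weight.
rewrite !ge0_integralZl//; last 6 first.
- by apply: emeasurable_funM => //; exact: measurable_poisson_weight.
- by move=> z _; rewrite mule_ge0 ?poisson_weight_ge0// lee_fin.
- by rewrite lee_fin divr_ge0 ?mulr_ge0// ltW.
- exact/measurable_EFinP.
- by move=> z _; rewrite lee_fin.
- by rewrite lee_fin ltW.
rewrite k1 mule1 [e in leRHS]splitr EFinD leeD//.
apply: (@le_trans _ _ ((2 * M / Z)%:E * (C2 * geometric_factor * (y / (d / 2)) `^ (2^-1))%:E)%E).
  by apply: lee_EFinMl (poisson_tail _ _ _) => //; rewrite divr_ge0 ?mulr_ge0// ltW.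
rewrite -EFinM lee_fin.
have ht : (y / (d / 2)) `^ (2^-1) <= t.
  have -> : t = (t ^+ 2) `^ 2^-1.
    by rewrite -powR_mulrn ?(ltW t0)// -powRrM mulfV// powRr1// ltW.
  have yd0 : 0 <= y / (d / 2) by rewrite divr_ge0// ltW.
  apply: ge0_ler_powR; rewrite ?nnegrE ?yd0 ?exprn_ge0 ?(ltW t0) ?invr_ge0//.
  by rewrite ler_pdivrMr// mulrC ltW.
apply: (@le_trans _ _ (T * t)).
  rewrite /T -!mulrA; apply: ler_wpM2l => //; apply: ler_wpM2l => //.
  apply: ler_pM; rewrite ?invr_ge0 ?(ltW Z0)//.
  - by rewrite !mulr_ge0 ?powR_ge0 ?(ltW C20) ?(ltW K0).
  - by rewrite lef_pV2.
  - by rewrite !ler_wpM2l ?(ltW C20) ?(ltW K0).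
rewrite /t mulrC mulrAC ler_pdivrMr ?ltr_wpDl// ler_wpM2l ?(ltW e2)//.
by rewrite lerDl.
Qed.

(** * Continuity of potentials of bounded functions *)

(** Moving the center by a distance t multiplies max(y, d) by at most c = 1 + t / y, and c^(-a) >= 1
    - a t / y by exp v >= 1 + v and ln(1 + v) <= v. Symmetry gives the absolute value. *)
Lemma trunc_kernel_lip (y : R) (x x0 u : X) : 0 < y ->
  `|trunc_kernel a y x u - trunc_kernel a y x0 u| <= y `^ (- a) * (a * (mdist x x0 / y)).
Proof.
move=> y0.
suff half (z z0 : X) : trunc_kernel a y z u - trunc_kernel a y z0 u <=
    y `^ (- a) * (a * (mdist z z0 / y)).
  by rewrite ler_norml lerNl opprB half andbT metric_sym half.
have d0 : 0 <= mdist z z0 / y by rewrite divr_ge0 ?mdist_ge0// ltW.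
pose c := 1 + mdist z z0 / y; have c0 : 0 < c by rewrite ltr_pwDl.
have mx : Num.max y (mdist z0 u) <= c * Num.max y (mdist z u).
  have ym : y <= Num.max y (mdist z u) by rewrite le_max lexx.
  have zm : mdist z u <= Num.max y (mdist z u) by rewrite le_max lexx orbT.
  have dm : mdist z z0 <= mdist z z0 / y * Num.max y (mdist z u).
    by rewrite mulrAC ler_pdivlMr// ler_wpM2l ?mdist_ge0.
  have d1 := mdist_ge0 z z0.
  rewrite ge_max /c mulrDl mul1r; apply/andP; split; first lra.
  have := metric_triangle z0 z u; rewrite (metric_sym z0 z); lra.
have tk := ler_powRN_scale (ltW a0) c0 (_ : 0 < Num.max y (mdist z0 u)) mx.
have {}tk : trunc_kernel a y z u * c `^ (- a) <= trunc_kernel a y z0 u.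
  rewrite powRN ler_pdivrMr ?powR_gt0// mulrC.
  by apply: tk; rewrite lt_max y0.
have cl : 1 - a * (mdist z z0 / y) <= c `^ (- a).
  rewrite /powR gt_eqF//; apply: le_trans (expR_ge1Dx _).
  rewrite mulNr lerD2l lerN2 ler_wpM2l ?(ltW a0)// /c; apply: le_ln1Dx.
  exact: lt_le_trans d0.
have tz0 : 0 < trunc_kernel a y z u by exact: trunc_kernel_gt0.
apply: (@le_trans _ _ (trunc_kernel a y z u * (a * (mdist z z0 / y)))); last first.
  apply: ler_wpM2r; first by apply: mulr_ge0; [exact: ltW|exact: d0].
  by apply: trunc_kernel_le => //; exact: ltW.
have := ler_wpM2l (ltW tz0) cl; rewrite mulrBr mulr1; lra.
Qed.

Lemma continuous_measurable_borel (g : X -> R) :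
  (forall x0, eps_continuous g x0) -> measurable_fun setT (g : borel X -> R).
Proof.
move=> gc; apply: (measurability _ (RGenOInfty.measurableE R)) => // _ [_ [r ->] <-].
rewrite setTI; apply: sub_sigma_algebra; rewrite openE => x /=.
rewrite in_itv/= andbT => rx.
have e0 : 0 < (g x - r) / 2 by rewrite divr_gt0// subr_gt0.
have [d d0 hd] := gc x _ e0.
apply/nbhs_ballP; exists d => // z; rewrite mem_ballE => /hd.
rewrite /= in_itv/= andbT ler_norml => /andP[]; lra.
Qed.

(** The kernel is its truncation at y plus an excess. The excess vanishes beyond distance y and has
    integral at most C y^(Q-a), small uniformly in the center; the truncated part is Lipschitz in
    the center. *)
Lemma riesz_potential_bounded (f : borel X -> R) (N : R) :
  measurable_fun setT f -> (forall u, `|f u| <= N) ->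
  exists g : X -> R, [/\ forall x, riesz_potential m Q s f x = (g x)%:E,
    forall x, m.-integrable setT (fun u : borel X => riesz_kernel Q s x u * (f u)%:E)%E,
    (exists M, forall x, `|g x| <= M) & forall x0, eps_continuous g x0].
Proof.
move=> mf fN; have N0 : 0 <= N by exact: le_trans (fN point).
have [CK [CK0 hCK]] := riesz_kernel_integral.
have [C [C0 hC]] := riesz_kernel_local.
have mrk (x : X) : measurable_fun setT (fun z : borel X => riesz_kernel Q s x (z : X)).
  by apply: measurable_riesz_kernel.
have mEf : measurable_fun setT (EFin \o f) by exact/measurable_EFinP.
have absN (k : borel X -> \bar R) : measurable_fun setT k -> (forall u, 0 <= k u)%E ->
    (\int[m]_u `|k u * (f u)%:E| <= N%:E * \int[m]_u k u)%E.
  move=> mk k0; rewrite -ge0_integralZl//.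
  apply: ge0_le_integral => //.
  - by apply: measurableT_comp => //; exact: emeasurable_funM.
  - exact: measurable_funeM.
  by move=> u _; rewrite abseM gee0_abs// muleC lee_wpmul2r// lee_fin.
have irk x : m.-integrable setT (fun u : borel X => riesz_kernel Q s x u * (f u)%:E)%E.
  apply/integrableP; split; first exact: emeasurable_funM.
  apply: le_lt_trans (absN _ (mrk x) (fun u => riesz_kernel_ge0 _ _)) _.
  apply: (@le_lt_trans _ _ (N%:E * CK%:E)%E); first exact: lee_EFinMl.
  by rewrite -EFinM ltry.
have fin x : riesz_potential m Q s f x \is a fin_num by exact: integrable_fin_num (irk x).
exists (fun x => fine (riesz_potential m Q s f x)); split.
- by move=> x; rewrite fineK.
- exact: irk.
- exists (N * CK) => x; rewrite -lee_fin -abse_EFin fineK// EFinM.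
  apply: le_trans (le_abse_integral _ _ _) _ => //; first exact: emeasurable_funM.
  apply: le_trans (absN _ (mrk x) (fun u => riesz_kernel_ge0 _ _)) _.
  exact: lee_EFinMl.
move=> x0 e e0.
have e3 : 0 < e / 3 by rewrite divr_gt0.
pose b := Q - a; have b0 : 0 < b by rewrite subr_gt0.
have NC0 : 0 < N * C + 1 by rewrite ltr_wpDl ?mulr_ge0.
(* The scale at which the excess contributes at most e / 3; adding 1 keeps the denominator positive
   when N C = 0. *)
pose y := (e / 3 / (N * C + 1)) `^ b^-1.
have eN0 : 0 < e / 3 / (N * C + 1) by rewrite divr_gt0.
have y0 : 0 < y by rewrite powR_gt0.
have yb : N * (C * y `^ b) <= e / 3.
  rewrite /y -powRrM mulVf ?gt_eqF// powRr1 ?(ltW eN0)//.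
  have -> : N * (C * (e / 3 / (N * C + 1))) = e / 3 * (N * C / (N * C + 1)).
    by field; rewrite gt_eqF.
  by rewrite -[leRHS]mulr1 ler_wpM2l ?(ltW e3)// ler_pdivrMr// mul1r lerDl.
pose tk (x : X) (u : borel X) : R := trunc_kernel a y x (u : X).
have mtkx x : measurable_fun setT (tk x) by exact: measurable_trunc_kernel.
have tk0 x u : 0 <= tk x u by exact: powR_ge0.
pose ex (x : X) (u : borel X) : \bar R := (riesz_kernel Q s x u - (tk x u)%:E)%E.
have ex0 x u : (0 <= ex x u)%E.
  by rewrite /ex sube_ge0//; exact: (trunc_kernel_le_riesz).
have mex x : measurable_fun setT (ex x).
  by apply: emeasurable_funB => //; exact/measurable_EFinP.
have exle x : (\int[m]_u ex x u <= (C * y `^ b)%:E)%E.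
  apply: le_trans (hC x y y0).
  rewrite [leRHS]integral_mkcond; apply: ge0_le_integral => //.
  - by apply/(measurable_restrictT _ _).1 => //; exact: measurable_funTS.
  move=> u _; rewrite patchE; case: ifPn => [_|].
    by rewrite /ex leeBlDr// leeDl// lee_fin.
  rewrite notin_setE mem_ballE => /negP; rewrite -leNgt => yu.
  rewrite /ex /tk /trunc_kernel max_r// /riesz_kernel.
  case: eqVneq yu => [->|_ _]; first by rewrite mdistxx leNgt y0.
  by rewrite -/a subee.
have iex x : m.-integrable setT (fun u => ex x u * (f u)%:E)%E.
  apply/integrableP; split; first exact: emeasurable_funM.
  apply: le_lt_trans (absN _ (mex x) (ex0 x)) _.
  apply: (@le_lt_trans _ _ (N%:E * (C * y `^ b)%:E)%E); first exact: lee_EFinMl.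
  by rewrite -EFinM ltry.
have mtkf x : measurable_fun setT (fun u => (tk x u * f u)%:E).
  by apply/measurable_EFinP; exact: measurable_funM.
have itk x : m.-integrable setT (fun u => (tk x u * f u)%:E)%E.
  apply/integrableP; split=> //.
  apply: (@le_lt_trans _ _ ((y `^ (- a) * N)%:E * m setT)%E).
    apply: ge0_integral_le_cst => //; first by apply: measurableT_comp.
    move=> u _; rewrite abse_EFin lee_fin normrM ger0_norm//.
    by apply: ler_pM => //; apply: trunc_kernel_le => //; exact: ltW.
  by rewrite -[X in (_ * X)%E]fineK ?fin_num_measure// -EFinM ltry.
have split_rk x : (riesz_potential m Q s f x =
    \int[m]_u (tk x u * f u)%:E + \int[m]_u (ex x u * (f u)%:E))%E.
  rewrite -integralD//; apply: eq_integral => u _.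
  rewrite EFinM -muleDl//.
  by rewrite /ex addeC subeK.
have [A AE] : exists A : X -> R, forall x, (\int[m]_u (tk x u * f u)%:E)%E = (A x)%:E.
  exists (fun x => fine (\int[m]_u (tk x u * f u)%:E)%E) => x; rewrite fineK//.
  exact: integrable_fin_num (itk x).
have [E EE] : exists E : X -> R, forall x,
    (\int[m]_u (ex x u * (f u)%:E))%E = (E x)%:E.
  exists (fun x => fine (\int[m]_u (ex x u * (f u)%:E))%E) => x; rewrite fineK//.
  exact: integrable_fin_num (iex x).
have gE x : fine (riesz_potential m Q s f x) = A x + E x.
  by rewrite split_rk AE EE.
have Ele x : `|E x| <= e / 3.
  rewrite -lee_fin -abse_EFin -EE.
  apply: le_trans (le_abse_integral _ _ _) _ => //; first exact: emeasurable_funM.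
  apply: le_trans (absN _ (mex x) (ex0 x)) _.
  by apply: le_trans (lee_EFinMl N0 (exle x)) _; exact: yb.
pose T := y `^ (- a) * (a / y) * N * fine (m setT).
have T0 : 0 <= T.
  have ay0 : 0 <= a / y by apply: divr_ge0; exact: ltW.
  have mT0 : 0 <= fine (m setT) by rewrite fine_ge0.
  by do 3![apply: mulr_ge0 => //]; exact: powR_ge0.
have Ale x : `|A x - A x0| <= T * mdist x x0.
  rewrite -lee_fin -abse_EFin EFinB -!AE.
  rewrite -integralB//; apply: le_trans (le_abse_integral _ _ _) _ => //.
    exact: measurable_int (integrableB measurableT (itk x) (itk x0)).
  apply: (@le_trans _ _ ((y `^ (- a) * (a * (mdist x x0 / y)) * N)%:E * m setT)%E).
    apply: ge0_integral_le_cst => //.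
      apply: measurableT_comp => //.
      exact: measurable_int (integrableB measurableT (itk x) (itk x0)).
    move=> u _; rewrite -EFinB abse_EFin lee_fin -mulrBl normrM.
    by apply: ler_pM => //; exact: trunc_kernel_lip.
  rewrite -[X in (_ * X)%E]fineK ?fin_num_measure// -EFinM lee_fin /T.
  by rewrite le_eqVlt; apply/orP; left; apply/eqP; field; rewrite gt_eqF.
exists (e / 3 / (T + 1)); first by rewrite divr_gt0// ltr_wpDl.
move=> z zx; have T1 : 0 < T + 1 by rewrite ltr_wpDl.
have Tz : T * mdist z x0 <= e / 3.
  apply: (@le_trans _ _ ((T + 1) * mdist x0 z)).
    by rewrite (metric_sym z) ler_wpM2r ?mdist_ge0// lerDl.
  by rewrite mulrC -ler_pdivlMr// ltW.
have -> : fine (riesz_potential m Q s f z) - fine (riesz_potential m Q s f x0) =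
    (A z - A x0) + (E z - E x0).
  by rewrite (gE z) (gE x0) opprD addrACA.
have -> : e = e / 3 + (e / 3 + e / 3) by field.
apply: le_trans (ler_normD _ _) _; apply: lerD; first exact: le_trans (Ale z) Tz.
by apply: le_trans (ler_normB _ _) _; apply: lerD; exact: Ele.
Qed.

(** * Cutoff and almost everywhere convergence *)

(** Large values are set to 0. At each point one of the two pieces vanishes, so their products with
    an infinite kernel value add up without a clash of signs. *)
Definition cutoff (f : borel X -> R) (N : R) (u : borel X) : R :=
  if `|f u| <= N then f u else 0.

Definition cutoff_rest (f : borel X -> R) (N : R) (u : borel X) : R := f u - cutoff f N u.

Lemma measurable_cutoff (f : borel X -> R) (N : R) :
  measurable_fun setT f -> measurable_fun setT (cutoff f N).
Proof.
move=> mf; apply: measurable_fun_ifT => //.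
by apply: measurable_fun_ler => //; exact: measurableT_comp.
Qed.

Lemma cutoff_rest_le (f : borel X -> R) (N : R) u : `|cutoff_rest f N u| <= `|f u|.
Proof. by rewrite /cutoff_rest /cutoff; case: ifP => _; rewrite ?subrr ?normr0 ?subr0. Qed.

Lemma cutoff_cvg (f : borel X -> R) (e : R) : f \in Lfun m p%:E -> 0 < e ->
  exists2 N : R, 0 <= N & (\int[m]_u (`|cutoff_rest f N u| `^ p)%:E < e%:E)%E.
Proof.
move=> fL e0; have mf : measurable_fun setT f by move: fL; rewrite inE => /andP[/[!inE]].
have mr (N : R) : measurable_fun setT (fun u => (`|cutoff_rest f N u| `^ p)%:E).
  apply/measurable_EFinP; apply: (measurableT_comp (measurable_powR _)).
  apply: measurableT_comp => //; apply: measurable_funB => //.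
  exact: measurable_cutoff.
have ig := Lfun_integrable (ltW p1) fL.
have [|||||_ _ cv] := @dominated_convergence _ _ _ m setT measurableT
  (fun n u => (`|cutoff_rest f n%:R u| `^ p)%:E) (cst 0%E) (fun u => (`|f u| `^ p)%:E).
- by move=> n; exact: mr.
- exact: measurable_cst.
- apply: aeW => u _; apply: cvg_near_cst; near=> n.
  have fn : `|f u| <= n%:R by near: n; exact: nbhs_infty_ger.
  by rewrite /cutoff_rest /cutoff fn subrr normr0 powR0 ?gt_eqF.
- exact: ig.
- apply: aeW => u n _; rewrite abse_EFin lee_fin ger0_norm ?powR_ge0//.
  by apply: ge0_ler_powR; rewrite ?nnegrE ?(ltW p0)// cutoff_rest_le.
move: cv; rewrite integral0 => /fine_cvgP[_ /cvgrPdist_lt /(_ _ e0) [n0 _ /(_ n0 (leqnn _))]] /=.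
rewrite sub0r normrN => h; exists n0%:R => //.
have fin : (\int[m]_u (`|cutoff_rest f n0%:R u| `^ p)%:E)%E \is a fin_num.
  rewrite ge0_fin_numE; last by apply: integral_ge0 => u _; rewrite lee_fin powR_ge0.
  move/integrableP : ig => [_]; apply: le_lt_trans.
  apply: ge0_le_integral => //.
  - apply: measurableT_comp => //; apply/measurable_EFinP.
    by apply: (measurableT_comp (measurable_powR _)); exact: measurableT_comp.
  - move=> u _; rewrite abse_EFin lee_fin (ger0_norm (powR_ge0 _ _)).
    by apply: ge0_ler_powR; rewrite ?nnegrE ?(ltW p0)// cutoff_rest_le.
by rewrite -(fineK fin) lte_fin; apply: le_lt_trans h; exact: ler_norm.
Unshelve. all: by end_near. Qed.

(** [Bad i] is contained in the level sets for all N at once, hence in measurable sets of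
    arbitrarily small measure. Level sets shrink as the level grows, so the countably many levels
    1/(i+1) suffice. *)
Lemma ae_small_rest (f : borel X -> R) : f \in Lfun m p%:E ->
  {ae m, forall x0 : borel X, forall e, 0 < e -> exists2 N : R, 0 <= N &
    ~ level_set (cutoff_rest f N) e (x0 : X)}.
Proof.
move=> fL; have mf : measurable_fun setT f by move: fL; rewrite inE => /andP[/[!inE]].
have mr (N : R) : measurable_fun setT (cutoff_rest f N).
  by apply: measurable_funB => //; exact: measurable_cutoff.
have [C [C0 hC]] := weak_type.
pose Bad (i : nat) : set (borel X) := [set x0 | forall N : R, 0 <= N ->
  level_set (cutoff_rest f N) i.+1%:R^-1 (x0 : X)].
apply: (@negligibleS _ _ _ _ (\bigcup_i Bad i)).
  move=> x0 /= /existsNP[e /not_implyP[e0 he]].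
  have [i ie] : exists i : nat, i.+1%:R^-1 < e.
    exists (Num.bound e^-1); rewrite invf_plt ?posrE//.
    apply: lt_le_trans (archi_boundP _) _; first by rewrite invr_ge0 ltW.
    by rewrite ler_nat.
  exists i => // N N0; apply: contrapT => nl; apply: he; exists N => // -[x [y [y0 y1 xy hl]]].
  by apply: nl; exists x, y; split=> //; apply: lt_trans hl; rewrite lte_fin.
apply: negligible_bigcup => i.
have l0 : 0 < i.+1%:R^-1 :> R by rewrite invr_gt0 ltr0n.
pose l : R := i.+1%:R^-1.
have pick (n : nat) : exists U : set (borel X), [/\ measurable U, Bad i `<=` U &
    (m U <= (n.+1%:R^-1)%:E)%E].
  have e0 : 0 < n.+1%:R^-1 * (l `^ p / C).
    by rewrite mulr_gt0 ?invr_gt0 ?ltr0n// divr_gt0 ?powR_gt0.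
  have [N N0 hN] := cutoff_cvg fL e0.
  have [U [mU hU mUle]] := hC (cutoff_rest f N) l (mr N) l0.
  exists U; split=> //; first by move=> x /(_ N N0) /hU.
  apply: (le_trans mUle).
  apply: (@le_trans _ _ ((C / l `^ p)%:E * (n.+1%:R^-1 * (l `^ p / C))%:E)%E).
    by apply: lee_EFinMl (ltW hN); rewrite divr_ge0 ?powR_ge0// ltW.
  rewrite -EFinM lee_fin le_eqVlt; apply/orP; left; apply/eqP; field.
  by rewrite !gt_eqF ?powR_gt0.
have [U hU] := choice pick.
exists (\bigcap_n U n); split.
- by apply: bigcap_measurable => // n _; have [] := hU n.
- apply/eqP; rewrite eq_le measure_ge0 andbT; apply/lee_addgt0Pr => e e0.
  rewrite add0e.
  have [n ne] : exists n : nat, n.+1%:R^-1 < e.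
    exists (Num.bound e^-1); rewrite invf_plt ?posrE//.
    apply: lt_le_trans (archi_boundP _) _; first by rewrite invr_ge0 ltW.
    by rewrite ler_nat.
  have [mUn _ Un] := hU n.
  apply: (@le_trans _ _ (m (U n))); last by apply: le_trans Un _; rewrite lee_fin ltW.
  apply: le_measure; rewrite ?inE//.
    by apply: bigcap_measurable => // k _; have [] := hU k.
  by move=> x; exact.
- by move=> x Bx n _; have [_ + _] := hU n; exact.
Qed.

Lemma poisson_riesz_approx (f : borel X -> R) (x0 : X) : f \in Lfun m p%:E ->
  (forall e, 0 < e -> exists2 N : R, 0 <= N &
    ~ level_set (cutoff_rest f N) e x0) ->
  exists2 F : R, riesz_potential m Q s f x0 = F%:E & forall e, 0 < e ->
    exists2 d, 0 < d & forall (x : X) (y : R), mdist x0 x < d -> 0 < y -> y < d ->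
      approach_region m Q s p Psi x0 (x, y) ->
      exists2 v : R, poisson_integral m Q (riesz_potential m Q s f) (x, y) = v%:E &
        `|v - F| <= e.
Proof.
move=> fL good; have mf : measurable_fun setT f by move: fL; rewrite inE => /andP[/[!inE]].
have intf : m.-integrable setT (EFin \o f).
  apply/Lfun1_integrable; apply: (@Lfun_subset _ _ _ m 1 p%:E) fL => //.
  - by rewrite lee_fin ltW.
  - by rewrite fin_num_measure.
  - by rewrite lee_fin ltW.
have [C [C0 hC]] := riesz_poisson_kernel.
have key e : 0 < e -> exists v0 : R, exists r : R,
    [/\ riesz_potential m Q s f x0 = (v0 + r)%:E, `|r| <= e &
    exists2 d, 0 < d & forall (x : X) (y : R), mdist x0 x < d -> 0 < y -> y < d ->
      approach_region m Q s p Psi x0 (x, y) ->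
      exists v t : R, [/\ poisson_integral m Q (riesz_potential m Q s f) (x, y) = (v + t)%:E,
        `|v - v0| <= e & `|t| <= C * e]].
  move=> e0; have [N N0 nl] := good e e0.
  pose h := cutoff_rest f N; pose fN := cutoff f N.
  have mfN : measurable_fun setT fN by exact: measurable_cutoff.
  have mh : measurable_fun setT h by exact: measurable_funB.
  have fE u : f u = fN u + h u by rewrite /h /cutoff_rest addrC subrK.
  have fNN u : `|fN u| <= N.
    by rewrite /fN /cutoff; case: ifP => //; rewrite normr0.
  have [g [gE ifN [M gM] gc]] := riesz_potential_bounded mfN fNN.
  have small (x : X) (y : R) : 0 < y -> y <= 1 ->
      eball x0 (Psi%:E * eta_star m Q s p x0 y)%E x ->
      (\int[m]_u (trunc_kernel a y x (u : X) * `|h u|)%:E <= e%:E)%E.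
    move=> y0 y1 xy; rewrite leNgt; apply/negP => lt; apply: nl.
    by exists x, y; split.
  (* The points (x0, y) may be used as well, so the maximal bound reaches the potential of the
     remainder at x0. *)
  have self y : 0 < y -> eball x0 (Psi%:E * eta_star m Q s p x0 y)%E x0.
    move=> y0; rewrite /eball/= mdistxx mule_gt0 ?lte_fin//.
    by apply: (@lt_le_trans _ _ y%:E); rewrite ?lte_fin// /eta_star le_max lexx.
  have mnh : measurable_fun setT (fun u => `|h u|) by exact: measurableT_comp.
  have mrk : measurable_fun setT (fun u : borel X => riesz_kernel Q s x0 (u : X)).
    by apply: measurable_riesz_kernel.
  have mrkh : measurable_fun setT (fun u : borel X => riesz_kernel Q s x0 u * (h u)%:E)%E.
    by apply: emeasurable_funM => //; exact/measurable_EFinP.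
  have rkh : (\int[m]_u `|riesz_kernel Q s x0 u * (h u)%:E| <= e%:E)%E.
    have cv := integral_trunc_kernel_cvg (x := x0) measurableT mnh (fun u => normr_ge0 (h u)).
    have -> : (\int[m]_u `|riesz_kernel Q s x0 u * (h u)%:E| =
        \int[m]_u (riesz_kernel Q s x0 u * `|h u|%:E))%E.
      by apply: eq_integral => u _; rewrite abseM gee0_abs ?riesz_kernel_ge0.
    rewrite -(cvg_lim _ cv)//; apply: lime_le; first exact: (cvgP _ cv).
    apply: nearW => n; apply: small; rewrite ?invr_gt0 ?ltr0n//.
      by rewrite invf_le1 ?ltr0n// ler1n.
    by apply: self; rewrite invr_gt0 ltr0n.
  have irkh : m.-integrable setT (fun u : borel X => riesz_kernel Q s x0 u * (h u)%:E)%E.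
    apply/integrableP; split=> //; exact: le_lt_trans rkh (ltry _).
  have finh : riesz_potential m Q s h x0 \is a fin_num by exact: integrable_fin_num irkh.
  exists (g x0), (fine (riesz_potential m Q s h x0)); split.
  - rewrite EFinD fineK// -gE /riesz_potential -integralD//.
    apply: eq_integral => u _; rewrite /fN /h /cutoff_rest /cutoff.
    by case: ifP => _; rewrite ?subrr ?subr0 mule0 ?adde0 ?add0e.
  - rewrite -lee_fin -abse_EFin fineK//.
    by apply: le_trans rkh; exact: le_abse_integral.
  have gdef : riesz_potential m Q s fN = EFin \o g by apply/funext => x; rewrite gE.
  have mg : measurable_fun setT (g : borel X -> R) by exact: continuous_measurable_borel.
  have [d d0 hd] := poisson_bounded_cvg mg gM (gc x0) e0.
  have d10 : 0 < Num.min d (Num.min 1 r0) by rewrite !lt_min d0 ltr01 r00.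
  exists (Num.min d (Num.min 1 r0)) => // x y.
  rewrite !lt_min => /andP[xd _] y0 /andP[yd /andP[y1 yr0]] [_ /= xy].
  have [v vE vg] := hd x y xd y0 yd.
  have [L [mL Lb PIE]] := hC x y y0 (ltW yr0).
  have iM (k : borel X -> R) : measurable_fun setT k -> (forall u, `|k u| <= `|f u|) ->
      m.-integrable setT (EFin \o k).
    move=> mk kf; apply: le_integrable intf => //; first exact/measurable_EFinP.
    by move=> u _; rewrite /= lee_fin.
  have ifN1 : m.-integrable setT (EFin \o fN).
    by apply: iM => // u; rewrite /fN /cutoff; case: ifP; rewrite ?normr0.
  have ih1 : m.-integrable setT (EFin \o h).
    by apply: iM => // u; exact: cutoff_rest_le.
  have iL (k : borel X -> R) : measurable_fun setT k -> m.-integrable setT (EFin \o k) ->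
      m.-integrable setT (fun u => (L u * k u)%:E).
    move=> mk ik; apply: (le_integrable measurableT _ _ (integrableZl measurableT (C * y `^ (- a)) ik)).
      by apply/measurable_EFinP; exact: measurable_funM.
    move=> u _; have /andP[L0 Lu] := Lb u; rewrite -EFinM /= lee_fin !normrM ler_wpM2r//.
    rewrite ger0_norm//; apply: le_trans Lu _; rewrite -normrM; apply: le_trans (ler_norm _).
    by apply: ler_wpM2l => //; apply: trunc_kernel_le => //; exact: ltW.
  have finLh : (\int[m]_u (L u * h u)%:E)%E \is a fin_num.
    by apply: integrable_fin_num => //; exact: iL.
  exists v, (fine (\int[m]_u (L u * h u)%:E)); split=> //.
  - rewrite PIE// EFinD fineK// -vE -gdef PIE// -integralD//; try exact: iL.
    by apply: eq_integral => u _; rewrite -EFinD fE mulrDr.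
  - rewrite -lee_fin -abse_EFin fineK// EFinM.
    apply: le_trans (lee_EFinMl C0 (small x y y0 (ltW y1) xy)).
    apply: le_trans (le_abse_integral _ _ _) _ => //.
      by apply/measurable_EFinP; exact: measurable_funM.
    rewrite -ge0_integralZl//.
    - apply: ge0_le_integral => //.
      + by apply: measurableT_comp => //; apply/measurable_EFinP; exact: measurable_funM.
      + apply: measurable_funeM; apply/measurable_EFinP; apply: measurable_funM => //; exact: measurable_trunc_kernel.
      move=> u _; have /andP[L0 Lu] := Lb u.
      by rewrite abse_EFin -EFinM lee_fin normrM ger0_norm// mulrA ler_wpM2r.
    - apply/measurable_EFinP; apply: measurable_funM => //; exact: measurable_trunc_kernel.
    - by move=> u _; rewrite lee_fin mulr_ge0 ?powR_ge0.
(* The decomposition v0 + r depends on the tolerance but always represents the same number, which is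
   named here. With e' = e / (C + 2) the errors are e' for the bounded part, C e' for the Poisson
   integral of the remainder and e' for its potential at x0. *)
have [v1 [r1 [FE _ _]]] := key 1 ltr01.
exists (v1 + r1) => // e e0.
have C20' : 0 < C + 2 by rewrite ltr_wpDl.
have [v0 [r [FE' rle [d d0 hd]]]] := key (e / (C + 2)) (divr_gt0 e0 C20').
exists d => // x y xd y0 yd reg.
have [v [t [PIE vv0 tle]]] := hd x y xd y0 yd reg.
exists (v + t) => //.
have -> : v1 + r1 = v0 + r by move: FE; rewrite FE' => -[].
have -> : v + t - (v0 + r) = (v - v0) + (t - r) by rewrite opprD addrACA.
have -> : e = e / (C + 2) + (C * (e / (C + 2)) + e / (C + 2)) by field; rewrite gt_eqF.
apply: le_trans (ler_normD _ _) _; apply: lerD => //.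
by apply: le_trans (ler_normB _ _) _; exact: lerD.
Qed.

Lemma poisson_riesz_ae (f : borel X -> R) : f \in Lfun m p%:E ->
  {ae m, forall x0 : X,
    poisson_integral m Q (riesz_potential m Q s f) P
      @[P --> within (approach_region m Q s p Psi x0) (nbhs (x0, 0 : R))]
      --> riesz_potential m Q s f x0}.
Proof.
move=> fL; apply: filterS (ae_small_rest fL) => x0 good.
have [F -> hF] := poisson_riesz_approx fL good.
have near_ok e : 0 < e -> \forall P \near within (approach_region m Q s p Psi x0)
    (nbhs (x0, 0 : R)), exists2 v : R,
    poisson_integral m Q (riesz_potential m Q s f) P = v%:E & `|v - F| <= e.
  move=> e0; have [d d0 hd] := hF e e0; rewrite near_withinE.
  exists (ball x0 d, ball (0 : R) d); first by split; exact: nbhsx_ballx.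
  move=> [x y] [/=]; rewrite mem_ballE => xd; rewrite /ball/= sub0r normrN => yd reg.
  have [y0 _] := reg; apply: hd => //; exact: le_lt_trans (ler_norm _) yd.
apply/fine_cvgP; split.
  by apply: filterS (near_ok 1 ltr01) => P [v -> _].
apply/cvgrPdist_le => e e0; apply: filterS (near_ok e e0) => P [v vE vF] /=.
by rewrite vE /= distrC.
Qed.

End ahlfors.

(** * Reduction of the theorem to the uniform bounds *)

(** Positive diameter makes regularity available at some radius [r0]. Finitely many balls of this
    radius cover the space, so its mass is finite, and adding m(X) / r0^Q to the upper constant
    takes care of all larger radii. *)
Lemma compact_ahlfors_bounds (R : realType) (X : pmetricType R)
    (m : {measure set (borel X) -> \bar R}) (Q : R) :
  compact [set: X] -> 0 < Q -> ahlfors_regular m Q ->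
  (0 < diam [set: X])%E ->
  (m setT < +oo)%E /\ exists C1 C2 r0 : R, ahlfors_bounds m Q C1 C2 r0.
Proof.
move=> hX Q0 [C1 [C2 [C10 C12 reg]]] dX.
have mball := @measurable_ball_borel R X.
have sc : @second_countable X by exact: (@compact_second_countable R X hX).
have C20 : 0 < C2 by exact: lt_le_trans C12.
have [r0 r00 r0d] : exists2 r0 : R, 0 < r0 & (r0%:E < diam [set: X])%E.
  move: dX; case: (diam [set: X]) => [d| |//]; last by exists 1 => //; exact: ltry.
  rewrite lte_fin => d0; exists (d / 2); first by rewrite divr_gt0.
  by rewrite lte_fin ltr_pdivrMr// ltr_pMr// ltr1n.
have {}reg (x : X) (r : R) : 0 < r -> r <= r0 ->
    ((C1 * r `^ Q)%:E <= m (ball x r) /\ m (ball x r) <= (C2 * r `^ Q)%:E)%E.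
  by move=> rgt0 rr0; apply: reg => //; apply: le_lt_trans r0d; rewrite lee_fin.
have fin : (m setT < +oo)%E.
  have [D _ cov] : finite_subset_cover [set: X] (fun x : X => ball x r0) [set: X].
    move: hX; rewrite compact_cover; apply.
      by move=> x _; exact: metric_ball_open.
    by move=> z _; exists z => //; rewrite mem_ballE mdistxx.
  pose t : seq X := finmap.enum_fset D.
  apply: (@le_lt_trans _ _ (\sum_(x <- t) m (ball x r0 : set (borel X)))%E).
    have := @measure_bigsetU_le _ _ _ m _ t (fun x : X => ball x r0) (fun x => mball x r0).
    apply: le_trans; apply: le_measure; rewrite ?inE//.
      by apply: bigsetU_measurable => x _; exact: mball.
    by rewrite -bigcup_seq; exact: cov.
  apply/lte_sum_pinfty => x _; apply: le_lt_trans (reg x r0 r00 (lexx _)).2 _.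
  exact: ltry.
have mT : m setT \is a fin_num by rewrite ge0_fin_numE// measure_ge0.
have rQ : 0 < r0 `^ Q by rewrite powR_gt0.
pose M := fine (m setT) / r0 `^ Q.
have M0 : 0 <= M by rewrite divr_ge0 ?fine_ge0// ltW.
split=> //; exists C1, (C2 + M), r0; split=> //.
- by rewrite ltr_pwDl.
- by move=> x r rgt0 rr0; exact: (reg x r rgt0 rr0).1.
move=> x r rgt0; have [rr0|rr0] := leP r r0.
  apply: le_trans (reg x r rgt0 rr0).2 _.
  by rewrite lee_fin ler_wpM2r ?powR_ge0// lerDl.
apply: (@le_trans _ _ (m setT)); first by apply: le_measure; rewrite ?inE.
rewrite -(fineK mT) lee_fin -[leLHS](divfK (lt0r_neq0 rQ)) -/M.
apply: ler_pM => //; [exact: ltW|by rewrite lerDr ltW|].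
by apply: ge0_ler_powR; rewrite ?nnegrE ?(ltW Q0) ?(ltW r00) ?(ltW rgt0) ?(ltW rr0).
Qed.

(** The whole space repeated is an admissible cover at every scale, and each term is 0^Q = 0 because
    Q > 0. *)
Lemma hausdorff_measure_diam0 (R : realType) (X : pmetricType R) (Q : R) :
  0 < Q -> (diam [set: X] <= 0)%E -> (hausdorff_measure Q [set: X] <= 0)%E.
Proof.
move=> Q0 d0; have dE : diam [set: X] = 0%E.
  by apply/eqP; rewrite eq_le d0 /diam le_max lexx.
apply: ge_ereal_sup => _ [delta delta0 <-].
apply: ereal_inf_lbound; exists (fun=> setT).
  split; first by move=> x _; exists 0%N.
  by move=> k; rewrite dE lee_fin ltW.
by rewrite eseries0// => k _ _; rewrite dE poweR0r ?gt_eqF.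
Qed.

(** Finiteness becomes an instance on the same function, so results on finite measures apply after
    rewriting. *)
Lemma finite_measure_of d (T : measurableType d) (R : realType)
    (m : {measure set T -> \bar R}) : (m setT < +oo)%E ->
  exists m' : {finite_measure set T -> \bar R}, m = m' :> {measure set T -> \bar R}.
Proof.
move=> mT; have mfin : fin_num_fun m.
  move=> A mA; rewrite ge0_fin_numE ?measure_ge0//.
  by apply: le_lt_trans mT; apply: le_measure; rewrite ?inE.
case: m mT mfin => f c mT mfin.
pose fin := @Measure_isFinite.Build _ T R (Measure.Pack c) mfin.
pose m' : {finite_measure set T -> \bar R} := HB.pack f c fin.
by exists m'.
Qed.

Theorem theorem4p8 (R : realType) (X : pmetricType R)
  (m : {measure set (borel X) -> \bar R}) (Q p p' s Psi : R)
  (hX : compact [set: X]) (hQ : 0 < Q)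
  (hm : is_hausdorff_measure m Q) (hreg : ahlfors_regular m Q)
  (hp : 1 < p) (hpp' : p^-1 + p'^-1 = 1)
  (hs : p'^-1 <= s) (hs1 : s < 1)
  (hPsi : 1 <= Psi) (hqa : quasi_additive m Q s p Psi)
  (f : borel X -> R) (hf : f \in Lfun m p%:E) :
  {ae m, forall x0 : X,
    poisson_integral m Q (riesz_potential m Q s f) P
      @[P --> within (approach_region m Q s p Psi x0) (nbhs (x0, 0 : R))]
      --> riesz_potential m Q s f x0}.
Proof.
(* In diameter 0 regularity is vacuous, but the Hausdorff measure of the space vanishes and every
   set is negligible. *)
have [d0|dX] := leP (diam [set: X]) 0%E.
  exists setT; split=> //.
  apply/eqP; rewrite eq_le measure_ge0 andbT hm//.
  exact: hausdorff_measure_diam0.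
have [mT [C1 [C2 [r0 ah]]]] := compact_ahlfors_bounds hX hQ hreg dX.
have s0 : 0 < s.
  apply: lt_le_trans hs; rewrite -[p'^-1](addKr p^-1) hpp' addrC subr_gt0.
  by rewrite invf_lt1// (lt_trans ltr01).
have [m' mE] := finite_measure_of mT.
move: ah hf; rewrite {}mE => ah hf.
exact: (poisson_riesz_ae ah hp hpp' s0 hs1 hPsi hf).
Qed.
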